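(* Let $\mathcal{A}$ be a cluster algebra (without coefficients), and let $f:\mathcal{A}\rightarrow\mathcal{A}$ be a $\mathbb{Z}$-algebra homomorphism. Then $f$ is a cluster automorphism if and only if there exist two (not necessarily distinct) clusters $\mathbf{x}$ and $\mathbf{z}$ of $\mathcal{A}$ such that $f(\mathbf{x})=\mathbf{z}$.
   Context: Write $[x]_+=\max\{x,0\}$. An $n\times n$ integer matrix $B$ is skew-symmetrizable if there is a diagonal integer matrix $D$ with positive diagonal entries such that $BD$ is skew-symmetric. Fix $n\ge 1$ and the ambient field $\mathcal{F}=\mathbb{Q}(u_1,\dots,u_n)$ of rational functions in $n$ variables. A labeled seed is a pair $(\mathbf{x},B)$, where $\mathbf{x}=(x_1,\dots,x_n)$ is an $n$-tuple of free generators of $\mathcal{F}$ and $B=(b_{ij})$ is an $n\times n$ skew-symmetrizable integer matrix. For $k\in\{1,\dots,n\}$ the mutation $\mu_k(\mathbf{x},B)=(\mathbf{x}',B')$ is given by $$x'_k=\frac{\prod_{i=1}^n x_i^{[b_{ik}]_+}+\prod_{i=1}^n x_i^{[-b_{ik}]_+}}{x_k},\qquad x'_i=x_i\ (i\ne k),$$ and $B'=\mu_k(B)=(b'_{ij})$ with $b'_{ij}=-b_{ij}$ if $i=k$ or $j=k$, and $b'_{ij}=b_{ij}+\mathrm{sgn}(b_{ik})[b_{ik}b_{kj}]_+$ otherwise. It is again a labeled seed, and $\mu_k$ is an involution. Seeds (and clusters) are labeled seeds (and their tuples $\mathbf{x}$) considered up to simultaneous permutation of the components of $\mathbf{x}$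 and of the rows and columns of $B$; so a cluster is regarded as a set of $n$ elements, and $f(\mathbf{x})=\mathbf{z}$ is an equality of sets. The cluster algebra $\mathcal{A}=\mathcal{A}(\mathbf{x}_{t_0},B_{t_0})$ is the $\mathbb{Z}$-subalgebra of $\mathcal{F}$ generated by all elements (cluster variables) of all clusters of labeled seeds obtained from the initial labeled seed $(\mathbf{x}_{t_0},B_{t_0})$ by finite sequences of mutations. The seeds (clusters) of $\mathcal{A}$ are the seeds (clusters) obtained in this way; any of them may serve as initial seed. For a seed $(\mathbf{x},B)$ and $x=x_k\in\mathbf{x}$, $\mu_x(\mathbf{x})$ denotes the cluster of $\mu_k(\mathbf{x},B)$, i.e. $(\mathbf{x}\setminus\{x_k\})\cup\{x'_k\}$; likewise for $\mu_z(\mathbf{z})$ with respect to a seed $(\mathbf{z},B')$. Cluster automorphism: a $\mathbb{Z}$-algebra automorphism $f:\mathcal{A}\to\mathcal{A}$ is a cluster automorphism if, for $\mathcal{A}=\mathcal{A}(\mathbf{x},B)$ with $(\mathbf{x},B)$ a seed of $\mathcal{A}$, there exists a seed $(\mathbf{z},B')$ of $\mathcal{A}$ (possibly equal to $(\mathbf{x},B)$) such that (1) $f(\mathbf{x})=\mathbf{z}$, and (2) $f(\mu_x(\mathbf{x}))=\mu_{f(x)}(\mathbf{z})$ for every $x\in\mathbf{x}$. That is, such a pair of seeds $(\mathbf{x},B)$, $(\mathbf{z},B')$ exists. *)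

(* Defs.v *)
From HB Require Import structures.
From mathcomp Require Import all_boot all_order all_algebra.
From mathcomp Require Import boolp finmap mpoly.

Set Implicit Arguments.
Unset Strict Implicit.
Unset Printing Implicit Defensive.

Import Order.TTheory GRing.Theory Num.Theory.
Local Open Scope ring_scope.

(* Q(u_1, ..., u_n) *)
Definition ambient (n : nat) : fieldType := {fraction {mpoly rat[n]}}.

Definition ambient_eval n (x : 'I_n -> ambient n) (p : {mpoly rat[n]}) :
    ambient n :=
  mmap (fun c : rat => tofrac (mpolyC n c)) x p.

(* Algebraic independence over Q together with Q(x_1, ..., x_n) being the whole
   ambient field. *)
Definition free_generators n (x : 'I_n -> ambient n) : Prop :=
  (forall p : {mpoly rat[n]}, ambient_eval x p = 0 -> p = 0) /\
  (forall y : ambient n, exists p q : {mpoly rat[n]},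
     ambient_eval x q != 0 /\ y = ambient_eval x p / ambient_eval x q).

Definition skew_symmetrizable n (B : 'M[int]_n) : Prop :=
  exists d : 'rV[int]_n,
    (forall i, 0 < d 0 i) /\ (B *m diag_mx d)^T = - (B *m diag_mx d).

(* The underlying data of a labeled seed; see [is_labeled_seed]. *)
Record seed_data (n : nat) := SeedData {
  seed_var : {ffun 'I_n -> ambient n};
  seed_mx : 'M[int]_n
}.

Definition is_labeled_seed n (s : seed_data n) : Prop :=
  free_generators (seed_var s) /\ skew_symmetrizable (seed_mx s).

Definition pos_part (b : int) : int := Num.max b 0.

Definition mutate_var n (s : seed_data n) (k : 'I_n) : ambient n :=
  (\prod_(i < n) seed_var s i ^ pos_part (seed_mx s i k) +
   \prod_(i < n) seed_var s i ^ pos_part (- seed_mx s i k)) / seed_var s k.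

Definition mutate_mx n (B : 'M[int]_n) (k : 'I_n) : 'M[int]_n :=
  \matrix_(i, j)
    if (i == k) || (j == k) then - B i j
    else B i j + sgz (B i k) * pos_part (B i k * B k j).

Definition mutate n (s : seed_data n) (k : 'I_n) : seed_data n :=
  SeedData [ffun i => if i == k then mutate_var s k else seed_var s i]
           (mutate_mx (seed_mx s) k).

Inductive mutation_reachable n (s0 : seed_data n) : seed_data n -> Prop :=
| reach_init : mutation_reachable s0 s0
| reach_mutate s k :
    mutation_reachable s0 s -> mutation_reachable s0 (mutate s k).

Definition cluster_variable n (s0 : seed_data n) (y : ambient n) : Prop :=
  exists s k, mutation_reachable s0 s /\ y = seed_var s k.

(* The Z-subalgebra generated by X, as the intersection of all subrings
   containing X. *)
Definition subring_gen (R : pzRingType) (X : R -> Prop) (y : R) : Prop :=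
  forall S : {pred R},
    subring_closed S -> (forall x, X x -> x \in S) -> y \in S.

Definition cluster_algebra_pred n (s0 : seed_data n) : {pred ambient n} :=
  fun y => `[< subring_gen (cluster_variable s0) y >].

Lemma cluster_algebra_predP n (s0 : seed_data n) y :
  reflect (subring_gen (cluster_variable s0) y)
          (y \in cluster_algebra_pred s0).
Proof. exact: asboolP. Qed.

Lemma cluster_algebra_subring n (s0 : seed_data n) :
  subring_closed (cluster_algebra_pred s0).
Proof.
split=> [|x y /cluster_algebra_predP Ax /cluster_algebra_predP Ay|
          x y /cluster_algebra_predP Ax /cluster_algebra_predP Ay];
  apply/cluster_algebra_predP => S HS HX; case: (HS) => S1 SB SM.
- exact: S1.
- by apply: SB; [apply: Ax | apply: Ay].
- by apply: SM; [apply: Ax | apply: Ay].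
Qed.

HB.instance Definition _ n (s0 : seed_data n) :=
  GRing.isSubringClosed.Build (ambient n) (cluster_algebra_pred s0)
    (cluster_algebra_subring s0).

(* A(x_{t0}, B_{t0}) for s0 = (x_{t0}, B_{t0}) *)
Record cluster_algebra n (s0 : seed_data n) := ClusterAlgebra {
  ca_val :> ambient n;
  _ : ca_val \in cluster_algebra_pred s0
}.

HB.instance Definition _ n (s0 : seed_data n) :=
  [isSub for @ca_val n s0].
HB.instance Definition _ n (s0 : seed_data n) :=
  [Choice of cluster_algebra s0 by <:].
HB.instance Definition _ n (s0 : seed_data n) :=
  [SubChoice_isSubComNzRing of cluster_algebra s0 by <:].

(* Labeled representatives of the seeds of A(s0). *)
Record seed_of n (s0 : seed_data n) := SeedOf {
  seed_of_data :> seed_data n;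
  seed_of_reachable : mutation_reachable s0 seed_of_data
}.

Definition mutate_seed n (s0 : seed_data n) (s : seed_of s0) (k : 'I_n) :
    seed_of s0 :=
  SeedOf (reach_mutate k (seed_of_reachable s)).

Lemma seed_var_in_cluster_algebra n (s0 : seed_data n) (s : seed_of s0) k :
  seed_var s k \in cluster_algebra_pred s0.
Proof.
apply/cluster_algebra_predP => S _; apply.
by exists s, k; split=> //; apply: seed_of_reachable.
Qed.

(* The k-th cluster variable of s, as an element of A(s0). *)
Definition cvar n (s0 : seed_data n) (s : seed_of s0) (k : 'I_n) :
    cluster_algebra s0 :=
  ClusterAlgebra (seed_var_in_cluster_algebra s k).

(* Clusters are unordered: labeled seeds equal up to a simultaneous permutation
   have the same cluster. *)
Definition cluster n (s0 : seed_data n) (s : seed_of s0) :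
    {fset cluster_algebra s0} :=
  [fset cvar s k | k : 'I_n]%fset.

Definition is_cluster n (s0 : seed_data n) (X : {fset cluster_algebra s0}) :
    Prop :=
  exists s : seed_of s0, X = cluster s.

(* In the last clause x = cvar s k, and l is the position of f(x) in the
   cluster of t. *)
Definition is_cluster_automorphism n (s0 : seed_data n)
    (f : cluster_algebra s0 -> cluster_algebra s0) : Prop :=
  bijective f /\
  exists s t : seed_of s0,
    (f @` cluster s)%fset = cluster t /\
    forall k l : 'I_n, f (cvar s k) = cvar t l ->
      (f @` cluster (mutate_seed s k))%fset = cluster (mutate_seed t l).

(* Main.v *)
Require Import Defs.
From HB Require Import structures.
From mathcomp Require Import all_boot all_order all_fingroup all_algebra.
From mathcomp Require Import boolp finmap mpoly zify ring lra.

(* Write f(x_k) = z_{s k} for a permutation s.  The point is that f(x'_k), which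
   lies in the cluster algebra and satisfies
     f(x'_k) z_{s k} = z^{[b_k]_+} + z^{[-b_k]_+},
   must be z'_{s k}, i.e. that column k of B, transported by s, is plus or minus
   column s k of the matrix B' of z.

   By the Laurent phenomenon, giving the variables of the seed mu_{s k}(z) the
   values 2^{u_i} sends every element of the cluster algebra into Z[1/2].
   Evaluating f(x'_k) yields (1 + 2^m) | (1 + 2^p) in Z[1/2], where m and p are
   the pairings of u with column s k of B' and with the transported column k of
   B.  Hence m | p for all u with m <> 0, so the second column is an integer
   multiple of the first, and nonzero if the first is.  The gcd of a column is
   invariant under mutation, and s permutes the columns, so the multiple is +-1.
   Thus f commutes with every single mutation, hence with all of them; it is then
   onto, and injective because it maps a free generating set of the fraction
   field to one.

   The Laurent phenomenon is proved for functions on positive rational points by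
   comparing a mutation sequence j, k, ... at a seed t0 with the seeds
   t1 = mu_j t0 and t3 = mu_j mu_k t1, which by induction already satisfy it:
   the new variables of t2 = mu_k t1 and t3 are Laurent at t0 and regular modulo
   the exchange polynomial P_j.  When b_jk = 0 this needs P_j and P_k coprime,
   which holds once the columns of B are linearly independent; that is arranged
   by adjoining frozen variables, later specialized to 1. *)

Set Implicit Arguments.
Unset Strict Implicit.
Unset Printing Implicit Defensive.

Import Order.TTheory GRing.Theory Num.Theory.
Local Open Scope ring_scope.

(** * Laurent polynomials as functions on positive rational points *)

Definition pos_pt N (x : {ffun 'I_N -> rat}) : Prop := forall i, 0 < x i.

Definition mon N (x : {ffun 'I_N -> rat}) (e : {ffun 'I_N -> int}) : rat :=
  \prod_i x i ^ e i.

Definition laurent_eval N (l : seq (int * {ffun 'I_N -> int})) x : rat :=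
  \sum_(t <- l) t.1%:~R * mon x t.2.

(** Only positive points are tested: mutation preserves positivity, so no denominator vanishes
    there. *)
Definition laurent N (f : {ffun 'I_N -> rat} -> rat) : Prop :=
  exists l, forall x, pos_pt x -> f x = laurent_eval l x.

Section Monomials.
Variable N : nat.
Implicit Types (x : {ffun 'I_N -> rat}) (e : {ffun 'I_N -> int}).

Lemma mon_gt0 x e : pos_pt x -> 0 < mon x e.
Proof. by move=> x0; apply: prodr_gt0 => i _; apply: exprz_gt0. Qed.

Lemma mon_neq0 x e : pos_pt x -> mon x e != 0.
Proof. by move=> x0; rewrite gt_eqF ?mon_gt0. Qed.

Lemma monD x e1 e2 : pos_pt x -> mon x (e1 + e2) = mon x e1 * mon x e2.
Proof.
move=> x0; rewrite /mon -big_split; apply: eq_bigr => i _.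
by rewrite ffunE expfzDr // gt_eqF.
Qed.

Lemma mon0 x : mon x 0 = 1.
Proof. by rewrite /mon big1 // => i _; rewrite ffunE. Qed.

Lemma monN x e : mon x (- e) = (mon x e)^-1.
Proof.
rewrite /mon -prodfV; apply: eq_bigr => i _.
by rewrite ffunE -invr_expz.
Qed.

Lemma monMz x e (m : int) : mon x (e *~ m) = mon x e ^ m.
Proof.
have prodXz (F : 'I_N -> rat) : (\prod_i F i) ^ m = \prod_i F i ^ m.
  by apply: (big_morph (fun y : rat => y ^ m) (fun a b => expfzMl a b m)); exact: exp1rz.
rewrite /mon prodXz; apply: eq_bigr => i _; rewrite exprz_exp; congr (_ ^ _).
elim/int_ind: m {prodXz} => [|m IH|m IH]; first by rewrite mulr0z ffunE mulr0.
- by rewrite -addn1 PoszD mulrzDr mulr1z ffunE IH mulrDr mulr1.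
- by rewrite -addn1 PoszD opprD mulrzDr mulrN1z 2!ffunE IH mulrDr mulrN1.
Qed.

Definition single_exp (k : 'I_N) (z : int) : {ffun 'I_N -> int} :=
  [ffun i => if i == k then z else 0].

Lemma mon_single x k z : mon x (single_exp k z) = x k ^ z.
Proof.
rewrite /mon (bigD1 k) //= ffunE eqxx big1 ?mulr1 // => i ik.
by rewrite ffunE (negPf ik).
Qed.

Lemma eq_mon (x y : {ffun 'I_N -> rat}) e : (forall i, e i != 0 -> x i = y i) -> mon x e = mon y e.
Proof.
move=> xy; apply: eq_bigr => i _; case: (eqVneq (e i) 0) => [->|/xy->] //.
Qed.

Lemma mon_update (x y : {ffun 'I_N -> rat}) (k : 'I_N) e :
  (forall i, i != k -> y i = x i) ->
  mon y e = mon x (e - single_exp k (e k)) * y k ^ e k.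
Proof.
move=> yx; rewrite /mon (bigD1 k) //= [in RHS](bigD1 k) //= !ffunE eqxx subrr.
rewrite expr0z mul1r mulrC; congr (_ * _); apply: eq_bigr => i ik.
by rewrite yx // !ffunE (negPf ik) subr0.
Qed.

Lemma laurent_ext f g :
  (forall x, pos_pt x -> f x = g x) -> laurent f -> laurent g.
Proof. by move=> fg [l fl]; exists l => x x0; rewrite -fg ?fl. Qed.

Lemma laurent_mon e : laurent (fun x => mon x e).
Proof. by exists [:: (1, e)] => x _; rewrite /laurent_eval big_seq1 /= mul1r. Qed.

Lemma laurent_int (c : int) : laurent (fun _ : {ffun 'I_N -> rat} => c%:~R).
Proof. by exists [:: (c, 0)] => x _; rewrite /laurent_eval big_seq1 /= mon0 mulr1. Qed.

Lemma laurentD f g : laurent f -> laurent g -> laurent (fun x => f x + g x).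
Proof.
move=> [l fl] [l' gl]; exists (l ++ l') => x x0.
by rewrite /laurent_eval big_cat /= fl ?gl.
Qed.

Lemma laurentM f g : laurent f -> laurent g -> laurent (fun x => f x * g x).
Proof.
move=> [l fl] [l' gl].
exists [seq (s.1 * t.1, s.2 + t.2) | s <- l, t <- l'] => x x0.
rewrite /laurent_eval big_allpairs_dep /= fl ?gl //.
rewrite /laurent_eval mulr_suml; apply: eq_bigr => s _.
rewrite mulr_sumr; apply: eq_bigr => t _ /=.
by rewrite monD // intrM; ring.
Qed.

Lemma laurentN f : laurent f -> laurent (fun x => - f x).
Proof.
move=> /(laurentM (laurent_int (-1))); apply: laurent_ext => x _.
by rewrite mulN1r.
Qed.

Lemma laurentB f g : laurent f -> laurent g -> laurent (fun x => f x - g x).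
Proof. by move=> lf /laurentN; apply: laurentD. Qed.

Lemma laurent_var k : laurent (fun x : {ffun 'I_N -> rat} => x k).
Proof. by apply: laurent_ext (laurent_mon (single_exp k 1)) => x _; rewrite mon_single. Qed.

Lemma laurentX f a : laurent f -> laurent (fun x => f x ^+ a).
Proof.
move=> lf; elim: a => [|a IH].
  by apply: laurent_ext (laurent_int 1) => x _; rewrite expr0.
by apply: laurent_ext (laurentM lf IH) => x _; rewrite exprS.
Qed.

Lemma laurent_sum (I : Type) (r : seq I) (F : I -> {ffun 'I_N -> rat} -> rat) :
  (forall i, laurent (F i)) -> laurent (fun x => \sum_(i <- r) F i x).
Proof.
move=> lF; elim: r => [|i r IH].
  by apply: laurent_ext (laurent_int 0) => x _; rewrite big_nil.
by apply: laurent_ext (laurentD (lF i) IH) => x _; rewrite big_cons.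
Qed.

Lemma laurent_prod (I : Type) (r : seq I) (F : I -> {ffun 'I_N -> rat} -> rat) :
  (forall i, laurent (F i)) -> laurent (fun x => \prod_(i <- r) F i x).
Proof.
move=> lF; elim: r => [|i r IH].
  by apply: laurent_ext (laurent_int 1) => x _; rewrite big_nil.
by apply: laurent_ext (laurentM (lF i) IH) => x _; rewrite big_cons.
Qed.

(** The number [a] bounds all exponents of [g] in absolute value, so the extra factor turns every
    power of a coordinate of [u] into a nonnegative one. *)
Lemma laurent_subst g (u : {ffun 'I_N -> rat} -> {ffun 'I_N -> rat}) :
  laurent g -> (forall x, pos_pt x -> pos_pt (u x)) ->
  (forall i, laurent (fun x => u x i)) ->
  exists a, laurent (fun x => g (u x) * (\prod_i u x i) ^+ a).
Proof.
move=> [l gl] u0 lu.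
pose a := \max_(t <- l) \max_i `|t.2 i|%N.
exists a.
have tle t i : t \in l -> (`|t.2 i| <= a)%N.
  move=> tl; apply: leq_trans (leq_bigmax_seq _ tl _) => //.
  exact: (@leq_bigmax _ (fun i => `|t.2 i|%N)).
apply: (@laurent_ext (fun x => \sum_(t <- [seq t <- l | t \in l])
   t.1%:~R * \prod_i u x i ^+ absz (t.2 i + a%:Z)%R)); last first.
  apply: laurent_sum => t; apply: laurentM; first exact: laurent_int.
  by apply: laurent_prod => i; apply: laurentX.
move=> x x0; rewrite gl; last exact: u0.
rewrite /laurent_eval mulr_suml big_filter [RHS]big_seq_cond.
rewrite [LHS]big_seq_cond; apply: congr_big => // t; first by rewrite andbb andbT.
rewrite andbb => tl; rewrite -mulrA; congr (_ * _).
rewrite -prodrXl -big_split; apply: eq_bigr => i _ /=.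
rewrite !exprnP -expfzDr; last by rewrite gt_eqF ?u0.
congr (_ ^ _); have := tle t i tl; move: (t.2 i) a {tle} => z a; lia.
Qed.

End Monomials.

(** Multiplied by a power of s, the sum becomes a polynomial that vanishes at all positive integers,
    hence is zero. Exponents may repeat in [l], so whole degrees are added up instead of single
    coefficients being set to zero. *)
Lemma exp_sum_truncate (l : seq (rat * int)) (D : int) :
  (forall s : rat, 0 < s -> \sum_(t <- l) t.1 * s ^ t.2 = 0) ->
  \sum_(t <- l | t.2 < D) t.1 = 0.
Proof.
(* [K] bounds [D] and all exponents in absolute value, so that [absz] is applied to nonnegative
   integers only. *)
move=> l0; pose K := (\max_(t <- l) `|t.2| + `|D|)%N.
have Kt t : t \in l -> (`|t.2| <= K)%N.
  by move=> tl; apply: leq_trans (leq_addr _ _); apply: leq_bigmax_seq.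
have KD : (`|D| <= K)%N by exact: leq_addl.
move: K Kt KD => K Kt KD.
pose e (t : rat * int) := absz (t.2 + K%:Z)%R.
pose p : {poly rat} := \sum_(t <- l) t.1 *: 'X^(e t).
have rootp (j : nat) : root p j.+1%:R.
  rewrite /root /p horner_sum.
  have /eqP := l0 j.+1%:R (ltr0Sn _ _).
  apply: contraTT => /negPf pj; suff -> : \sum_(t <- l) t.1 * j.+1%:R ^ t.2 =
    j.+1%:R ^ (- K%:Z) * \sum_(t <- l) (t.1 *: 'X^(e t)).[j.+1%:R].
    by apply/negP; rewrite mulf_eq0 pj orbF expfz_eq0 pnatr_eq0 andbF.
  rewrite mulr_sumr big_seq_cond [RHS]big_seq_cond; apply: eq_bigr => t.
  rewrite andbT => tl; rewrite hornerZ hornerXn mulrCA; congr (_ * _).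
  rewrite exprnP -expfzDr ?pnatr_eq0 //; congr (_ ^ _); have := Kt _ tl.
  by rewrite /e; move: (t.2) => z; lia.
have p0 : p = 0.
  apply: (@roots_geq_poly_eq0 _ _ [seq j.+1%:R | j <- iota 0 (size p)]).
  - by apply/allP => _ /mapP [j _ ->].
  - rewrite map_inj_uniq ?iota_uniq // => i j /eqP.
    by rewrite eqr_nat => /eqP [].
  - by rewrite size_map size_iota.
have : \sum_(i < absz (D + K%:Z)%R) p`_i = 0.
  by apply: big1 => i _; rewrite p0 coef0.
under eq_bigr => i _ do rewrite /p coef_sum.
rewrite exchange_big /= => E0; rewrite -[RHS]E0 big_mkcond /= [LHS]big_seq [RHS]big_seq.
apply: eq_bigr => t tl; under eq_bigr => i _ do rewrite coefZ coefXn.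
rewrite -mulr_sumr.
have etD : (t.2 < D) = (e t < absz (D + K%:Z)%R)%N.
  by have := Kt _ tl; rewrite /e; move: (t.2) KD => z; lia.
case: ifP => [tD|/negbT tD].
  rewrite etD in tD; rewrite (bigD1 (Ordinal tD)) //= eqxx big1 ?addr0 ?mulr1 //.
  by move=> i /eqP it; case: eqP => // ie; case: it; apply: val_inj.
rewrite etD -leqNgt in tD; rewrite big1 ?mulr0 // => i _.
by case: eqP => // ie; have := ltn_ord i; rewrite ie ltnNge tD.
Qed.

(** * Coprimality to an exchange polynomial *)

Definition dot N (p : 'I_N -> int) (e : {ffun 'I_N -> int}) : int :=
  \sum_i p i * e i.

Section Regularity.
Variable N : nat.
Implicit Types (x : {ffun 'I_N -> rat}) (e m b : {ffun 'I_N -> int}).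
Implicit Types (P V W S h q : {ffun 'I_N -> rat} -> rat) (p : 'I_N -> int).

(** This is coprimality in the form that is used: [V] is a non-zero-divisor modulo [P] in the
    Laurent polynomials. *)
Definition regular_mod P V : Prop :=
  forall h q, laurent h -> laurent q ->
    (forall x, pos_pt x -> V x * h x = P x * q x) ->
  exists q', laurent q' /\ forall x, pos_pt x -> h x = P x * q' x.

Lemma regular_ext P V W :
  (forall x, pos_pt x -> V x = W x) -> regular_mod P V -> regular_mod P W.
Proof.
move=> VW rV h q lh lq Wh; apply: rV lh lq _ => x x0.
by rewrite VW // Wh.
Qed.

Lemma regular_mon P e : regular_mod P (fun x => mon x e).
Proof.
move=> h q lh lq Vh; exists (fun x => mon x (- e) * q x).
split; first by apply: laurentM => //; exact: laurent_mon.
move=> x x0; rewrite mulrCA -Vh // monN mulrA mulVf ?mul1r //.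
exact: mon_neq0.
Qed.

Lemma regularM P V W :
  laurent W -> regular_mod P V -> regular_mod P W -> regular_mod P (fun x => V x * W x).
Proof.
move=> lW rV rW h q lh lq VWh.
have [|q1 [lq1 Wh]] := rV (fun x => W x * h x) q (laurentM lW lh) lq.
  by move=> x x0; rewrite mulrA VWh.
exact: rW lh lq1 Wh.
Qed.

Lemma regularX P V a : laurent V -> regular_mod P V -> regular_mod P (fun x => V x ^+ a).
Proof.
move=> lV rV; elim: a => [|a IH].
  by apply: regular_ext (@regular_mon P 0) => x _; rewrite mon0 expr0.
apply: regular_ext (regularM (laurentX a lV) rV IH) => x _.
by rewrite exprS.
Qed.

Lemma regular_prod P (I : Type) (r : seq I) (F : I -> {ffun 'I_N -> rat} -> rat) :
  (forall i, laurent (F i)) -> (forall i, regular_mod P (F i)) ->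
  regular_mod P (fun x => \prod_(i <- r) F i x).
Proof.
move=> lF rF; elim: r => [|i r IH].
  by apply: regular_ext (@regular_mon P 0) => x _; rewrite mon0 big_nil.
apply: regular_ext (regularM (laurent_prod r lF) (rF i) IH) => x _.
by rewrite big_cons.
Qed.

(** Only the class of [V] modulo [P] matters: the term P S h is moved into the quotient. *)
Lemma regular_addM P V S :
  laurent S -> regular_mod P V -> regular_mod P (fun x => V x + P x * S x).
Proof.
move=> lS rV h q lh lq VSh.
apply: rV lh (laurentB lq (laurentM lS lh)) _ => x x0.
by rewrite mulrBr -VSh //; ring.
Qed.

Lemma regular_associate P e V :
  regular_mod P V -> regular_mod (fun x => mon x e * P x) V.
Proof.
move=> rV h q lh lq Vh.
have lM := laurent_mon e; have lN := laurent_mon (- e).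
have [|q' [lq' hq']] := rV h (fun x => mon x e * q x) lh (laurentM lM lq).
  by move=> x x0; rewrite Vh //; ring.
exists (fun x => mon x (- e) * q' x); split; first exact: laurentM.
move=> x x0; rewrite hq' // monN; field; exact: mon_neq0.
Qed.

(* The weights p make [mon x b] homogeneous of degree 0 and [mon x m] of degree
   d <> 0.  Multiplying by a geometric sum replaces 1 + c x^m by
   1 - (-c x^m)^r, and for r large the two terms of (1 - (-c x^m)^r) h live in
   disjoint degrees, so that truncation by degree isolates h. *)
Lemma regular_binomial b m p (c : int) :
  dot p b = 0 -> dot p m != 0 ->
  regular_mod (fun x => 1 + mon x b) (fun x => 1 + c%:~R * mon x m).
Proof.
move=> pb pm0; wlog pm : p pb pm0 / 0 < dot p m => [wh|].
  case: (ltrP 0 (dot p m)) => [pm|pm]; first exact: (wh p).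
  have dN e : dot (fun i => - p i) e = - dot p e.
    by rewrite /dot -sumrN; apply: eq_bigr => i _; rewrite mulNr.
  apply: (wh (fun i => - p i)); rewrite dN ?pb ?oppr0 ?oppr_eq0 ?oppr_gt0 //.
  by rewrite lt_neqAle pm0.
move=> h q [lh hE] lq Vh.
have dotD e1 e2 : dot p (e1 + e2) = dot p e1 + dot p e2.
  by rewrite /dot -big_split; apply: eq_bigr => i _; rewrite ffunE mulrDr.
have dotMn e k : dot p (e *+ k) = dot p e *+ k.
  elim: k => [|k IH]; last by rewrite !mulrS dotD IH.
  by rewrite /dot big1 // => i _; rewrite ffunE mulr0.
pose D := (\max_(t <- lh) `|dot p t.2|).+1%N.
have Dt t : t \in lh -> (`|dot p t.2| < D)%N.
  by move=> tl; rewrite ltnS; apply: (@leq_bigmax_seq _ _ xpredT (fun t => `|dot p t.2|%N)).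
(* The degrees of [h] exceed - D and [dot p m] is at least 1, so multiplication by x^(r m) lifts
   them all above D. *)
move: D Dt => D Dt; pose r := (2 * D)%N.
have lG : laurent (fun x => q x * \sum_(i <- iota 0 r) (- (c%:~R * mon x m)) ^+ i).
  apply: laurentM => //; apply: laurent_sum => i; apply: laurentX.
  by apply/laurentN/laurentM; [exact: laurent_int | exact: laurent_mon].
case: lG => lQ QE.
(* The quotient is the part of degree below [D] of [q] times the geometric sum. *)
exists (laurent_eval [seq t <- lQ | dot p t.2 < D%:Z]).
split; first by exists [seq t <- lQ | dot p t.2 < D%:Z].
move=> x x0.
(* A one-parameter torus action: it scales x^e by s to the power of its degree. *)
pose y (s : rat) : {ffun 'I_N -> rat} := [ffun i => x i * s ^ p i].
have y0 s : 0 < s -> pos_pt (y s).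
  by move=> s0 i; rewrite ffunE mulr_gt0 ?exprz_gt0.
have mony s e : 0 < s -> mon (y s) e = mon x e * s ^ dot p e.
  move=> s0; rewrite /mon /dot.
  rewrite (big_morph (fun z : int => s ^ z) (id1 := 1) (op1 := *%R)).
  - rewrite -big_split; apply: eq_bigr => i _ /=.
    by rewrite ffunE expfzMl exprz_exp.
  - by move=> u v; rewrite expfzDr // gt_eqF.
  - by rewrite expr0z.
(* With z = - c x^m and Q the product expanded as [lQ], these are the terms of (1 + x^b) Q - h + z^r
   h, which vanishes because (1 - z) h = (1 + x^b) q. *)
pose L : seq (rat * int) :=
  [seq ((1 + mon x b) * (t.1%:~R * mon x t.2), dot p t.2) | t <- lQ]
  ++ [seq (- (t.1%:~R * mon x t.2), dot p t.2) | t <- lh]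
  ++ [seq ((- c)%:~R ^+ r * t.1%:~R * mon x (t.2 + m *+ r), dot p (t.2 + m *+ r))
       | t <- lh].
have /(exp_sum_truncate D%:Z) : forall s, 0 < s -> \sum_(t <- L) t.1 * s ^ t.2 = 0.
  move=> s s0; rewrite !big_cat !big_map /=.
  have E1 : \sum_(t <- lQ) (1 + mon x b) * (t.1%:~R * mon x t.2) * s ^ dot p t.2
     = (1 + mon (y s) b) * laurent_eval lQ (y s).
    rewrite /laurent_eval mulr_sumr; apply: eq_bigr => t _.
    by rewrite !mony // pb expr0z mulr1 -!mulrA.
  have E2 : \sum_(t <- lh) - (t.1%:~R * mon x t.2) * s ^ dot p t.2
     = - laurent_eval lh (y s).
    rewrite /laurent_eval -sumrN; apply: eq_bigr => t _.
    by rewrite !mony // mulrA mulNr.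
  have E3 : \sum_(t <- lh) (- c)%:~R ^+ r * t.1%:~R * mon x (t.2 + m *+ r) *
        s ^ dot p (t.2 + m *+ r) = (- (c%:~R * mon (y s) m)) ^+ r * laurent_eval lh (y s).
    rewrite /laurent_eval mulr_sumr; apply: eq_bigr => t _.
    rewrite -[LHS]mulrA -mony // monD; last exact: y0.
    have -> : mon (y s) (m *+ r) = mon (y s) m ^+ r by rewrite pmulrn monMz.
    by rewrite intrN -mulNr [in RHS]exprMn; ring.
  rewrite E1 E2 E3 -QE -?hE; try exact: y0.
  have := Vh (y s) (y0 s s0); move: (mon (y s) b) (h (y s)) (q (y s)) => B H Q E.
  rewrite mulrA -E.
  set z := - _; have -> : 1 + c%:~R * mon (y s) m = 1 - z by rewrite opprK.
  have := subrX1 z r; rewrite -(big_mkord xpredT (fun i => z ^+ i)) /index_iota subn0 => zr.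
  have -> : (1 - z) * H * (\sum_(i <- iota 0 r) z ^+ i) =
    - H * ((z - 1) * (\sum_(i <- iota 0 r) z ^+ i)) by ring.
  by rewrite -zr; ring.
rewrite !big_cat !big_map /= [X in _ + (_ + X)]big_seq_cond [X in _ + (_ + X)]big1; last first.
  move=> t /andP[/Dt tD]; rewrite dotD dotMn => lt; exfalso.
  move: tD lt pm; rewrite /r -mulr_natl; move: (dot p t.2) (dot p m) => u v; nia.
rewrite addr0 -mulr_sumr /laurent_eval big_filter => /eqP.
rewrite addr_eq0 => /eqP ->.
rewrite hE // /laurent_eval -sumrN [RHS]big_mkcond [LHS]big_seq [RHS]big_seq.
apply: eq_bigr => t /Dt tD; rewrite opprK; case: ifP => // /negP; case.
by move: tD; move: (dot p t.2) => u; lia.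
Qed.

End Regularity.

(** * Mutation of matrices *)

Section MatrixMutation.
Variable n : nat.
Implicit Types (B : 'M[int]_n) (i j k : 'I_n).

(** Removing [sgz] makes the mutation rule polynomial in entries and positive parts, so that linear
    relations and divisibility can be carried through it. *)
Lemma sgz_mul_pos_part (b c : int) :
  sgz b * pos_part (b * c) = pos_part (- b) * c + b * pos_part c.
Proof. by rewrite /pos_part; case: sgzP => hb; nia. Qed.

Lemma mutate_mx_pos_part B i j k : i != k -> j != k ->
  mutate_mx B k i j = B i j + pos_part (- B i k) * B k j + B i k * pos_part (B k j).
Proof.
by move=> /negPf ik /negPf jk; rewrite mxE ik jk /= sgz_mul_pos_part addrA.
Qed.

Lemma mutate_mxl B j k : mutate_mx B k k j = - B k j.
Proof. by rewrite mxE eqxx. Qed.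

Lemma mutate_mxr B i k : mutate_mx B k i k = - B i k.
Proof. by rewrite mxE eqxx orbT. Qed.

Lemma mutate_mxK B k : mutate_mx (mutate_mx B k) k = B.
Proof.
apply/matrixP => i j; have [->|ik] := eqVneq i k.
  by rewrite !mutate_mxl opprK.
have [->|jk] := eqVneq j k; first by rewrite !mutate_mxr opprK.
rewrite mutate_mx_pos_part // mutate_mx_pos_part // mutate_mxl mutate_mxr.
by rewrite /pos_part; lia.
Qed.

Lemma mutate_mxN B k : mutate_mx (- B) k = - mutate_mx B k.
Proof.
apply/matrixP => i j; rewrite [RHS]mxE; have [->|ik] := eqVneq i k.
  by rewrite !mutate_mxl mxE.
have [->|jk] := eqVneq j k; first by rewrite !mutate_mxr mxE.
rewrite !mutate_mx_pos_part // !mxE /pos_part.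
by move: (B i j) (B i k) (B k j) => a b c; nia.
Qed.

Lemma skew_symmetrizableP B :
  skew_symmetrizable B <->
  exists d : 'I_n -> int,
    (forall i, 0 < d i) /\ forall i j, B i j * d j = - (B j i * d i).
Proof.
split=> [[d [d0 /matrixP Bd]]|[d [d0 Bd]]].
  exists (fun i => d 0 i); split=> // i j.
  by have := Bd j i; rewrite mul_mx_diag !mxE.
exists (\row_i d i); split=> [i|]; first by rewrite mxE.
by apply/matrixP => i j; rewrite mul_mx_diag !mxE Bd.
Qed.

(** The same symmetrizer [d] serves after mutation, because [pos_part] commutes with multiplication
    by a positive number. *)
Lemma skew_mutate B k : skew_symmetrizable B -> skew_symmetrizable (mutate_mx B k).
Proof.
move/skew_symmetrizableP => [d [d0 Bd]]; apply/skew_symmetrizableP.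
exists d; split=> // i j; have [->|ik] := eqVneq i k.
  by rewrite mutate_mxl mutate_mxr !mulNr Bd.
have [->|jk] := eqVneq j k; first by rewrite mutate_mxl mutate_mxr !mulNr Bd.
rewrite !mutate_mx_pos_part // !mulrDl Bd !opprD -!addrA; congr (_ + _).
have := d0 i; have := d0 j; have := d0 k; have := Bd i k; have := Bd j k.
move: (B i k) (B k i) (B j k) (B k j) (d i) (d j) (d k).
move=> a a' b b' x y z bz az z0 y0 x0.
have posM (u w : int) : 0 < w -> pos_part u * w = pos_part (u * w).
  by rewrite /pos_part => w0; nia.
have -> : pos_part (- a) * b' * y = - (pos_part (- a) * z * b).
  by rewrite -!mulrA (mulrC z b) bz mulrN opprK.
have -> : pos_part (- b) * a' * x = - (pos_part (- b) * z * a).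
  by rewrite -!mulrA (mulrC z a) az mulrN opprK.
have -> : a * pos_part b' * y = a * pos_part (- b * z).
  by rewrite -mulrA posM // mulNr bz opprK.
have -> : b * pos_part a' * x = b * pos_part (- a * z).
  by rewrite -mulrA posM // mulNr az opprK.
by rewrite -!posM //; ring.
Qed.

Lemma skewN B : skew_symmetrizable B -> skew_symmetrizable (- B).
Proof.
move/skew_symmetrizableP => [d [d0 Bd]]; apply/skew_symmetrizableP.
by exists d; split=> // i j; rewrite !mxE !mulNr Bd.
Qed.

Lemma skew_diag B k : skew_symmetrizable B -> B k k = 0.
Proof.
move/skew_symmetrizableP => [d [d0 Bd]].
by have := Bd k k; have := d0 k; move: (B k k) (d k) => a b; nia.
Qed.

Lemma skew_gt0 B i j : skew_symmetrizable B -> (0 < B i j) = (B j i < 0).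
Proof.
move/skew_symmetrizableP => [d [d0 Bd]].
have := Bd i j; have := d0 i; have := d0 j.
by move: (B i j) (B j i) (d i) (d j) => a b c e; nia.
Qed.

Lemma skew_eq0 B i j : skew_symmetrizable B -> (B i j == 0) = (B j i == 0).
Proof.
move=> sB; have := skew_gt0 i j sB; have := skew_gt0 j i sB.
by move: (B i j) (B j i) => a b; lia.
Qed.

(** The columns in [M] are linearly independent; [M] will be the set of directions in which mutation
    takes place. *)
Definition cols_free (M : {pred 'I_n}) B : Prop :=
  forall c : 'I_n -> int, (forall j, j \notin M -> c j = 0) ->
    (forall i, \sum_j B i j * c j = 0) -> forall j, c j = 0.

(** A relation [c] between columns of the mutated matrix becomes a relation [c'] for [B] by changing
    only the coefficient at [k]. Row [k] of the relation, [Sk], removes the terms with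
    [pos_part (- B i k)]. *)
Lemma cols_free_mutate (M : {pred 'I_n}) B k :
  k \in M -> B k k = 0 -> cols_free M B -> cols_free M (mutate_mx B k).
Proof.
move=> kM Bkk fB c cM Bc.
pose c' j := if j == k then - c k + \sum_(j | j != k) pos_part (B k j) * c j else c j.
have Sk : \sum_(j | j != k) B k j * c j = 0.
  have /eqP := Bc k; rewrite (bigD1 k) //= mutate_mxl Bkk oppr0 mul0r add0r.
  under eq_bigr => j _ do rewrite mutate_mxl mulNr.
  by rewrite sumrN oppr_eq0 => /eqP.
have c'0 : forall j, c' j = 0.
  apply: fB => [j jM|i].
    by rewrite /c' (negPf (_ : j != k)) ?cM //; apply: contraNneq jM => ->.
  rewrite (bigD1 k) //= {1}/c' eqxx.
  have -> : \sum_(j | j != k) B i j * c' j = \sum_(j | j != k) B i j * c j.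
    by apply: eq_bigr => j /negPf jk; rewrite /c' jk.
  have [->|ik] := eqVneq i k; first by rewrite Bkk mul0r add0r.
  have := Bc i; rewrite (bigD1 k) //= mutate_mxr => E.
  rewrite -[RHS]E mulrDr mulrN mulNr -addrA; congr (_ + _).
  have -> : \sum_(j | j != k) mutate_mx B k i j * c j =
      \sum_(j | j != k) ((B i j * c j + B i k * (pos_part (B k j) * c j))
        + pos_part (- B i k) * (B k j * c j)).
    by apply: eq_bigr => j jk; rewrite mutate_mx_pos_part //; ring.
  by rewrite !big_split /= -!mulr_sumr Sk mulr0 addr0 addrC.
have cj j : j != k -> c j = 0.
  by move=> /negPf jk; have := c'0 j; rewrite /c' jk.
move=> j; have [->|/cj//] := eqVneq j k.
have := c'0 k; rewrite /c' eqxx big1 => [|i /cj->]; last by rewrite mulr0.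
by rewrite addr0 => /eqP; rewrite oppr_eq0 => /eqP.
Qed.

(** If all these minors vanished, then for each row q the numbers B q k and - B q j would be the
    coefficients of a relation between columns j and k. Independence would make column k zero, which
    is again a relation. *)
Lemma cols_free_minor (M : {pred 'I_n}) B j k :
  cols_free M B -> j \in M -> k \in M -> j != k ->
  exists p q, B p j * B q k != B q j * B p k.
Proof.
move=> fB jM kM jk; apply: contrapT => nminor.
have minor p q : B p j * B q k = B q j * B p k.
  by apply/eqP; apply: contra_notT nminor => ?; exists p, q.
have sum2 p q : \sum_l B p l *
   (if l == j then B q k else if l == k then - B q j else 0) = 0.
  have kj : k != j by rewrite eq_sym.
  rewrite (bigD1 j) //= eqxx (bigD1 k) //= eqxx (negPf kj).
  rewrite big1 => [|l /andP[/negPf-> /negPf->]]; last by rewrite mulr0.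
  by rewrite addr0 minor; ring.
have Bk q : B q k = 0.
  have := fB _ _ (sum2 ^~ q) j; rewrite eqxx; apply=> l lM.
  have lj : l != j by apply: contraNneq lM => ->.
  have lk : l != k by apply: contraNneq lM => ->.
  by rewrite (negPf lj) (negPf lk).
suff : (1 : int) = 0 by [].
have := fB (fun l => (l == k)%:Z) _ _ k; rewrite eqxx; apply=> [l lM|q].
  by rewrite (negPf (_ : l != _)) //; apply: contraNneq lM => ->.
by apply: big1 => l _; case: eqP => [->|_]; rewrite ?Bk ?mul0r ?mulr0.
Qed.

End MatrixMutation.

(** * The Laurent phenomenon *)

Definition exchange (K : fieldType) n (x : 'I_n -> K) (B : 'M[int]_n) k : K :=
  \prod_(i < n) x i ^ pos_part (B i k) + \prod_(i < n) x i ^ pos_part (- B i k).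

Definition mutate_pt n (x : {ffun 'I_n -> rat}) (B : 'M[int]_n) k :
    {ffun 'I_n -> rat} :=
  [ffun i => if i == k then exchange x B k / x k else x i].

Fixpoint mutate_pts n (w : seq 'I_n) (x : {ffun 'I_n -> rat}) (B : 'M[int]_n) :=
  if w is k :: w' then mutate_pts w' (mutate_pt x B k) (mutate_mx B k) else x.

Section PointMutation.
Variable n : nat.
Implicit Types (B : 'M[int]_n) (i j k : 'I_n) (x : {ffun 'I_n -> rat}).
Implicit Types (w : seq 'I_n) (e : {ffun 'I_n -> int}).

Lemma exchangeN (K : fieldType) (x : 'I_n -> K) B k : exchange x (- B) k = exchange x B k.
Proof.
rewrite /exchange addrC; congr (_ + _); apply: eq_bigr => i _; rewrite mxE //.
by rewrite opprK.
Qed.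

Lemma eq_exchange (K : fieldType) (x y : 'I_n -> K) B (C : 'M_n) k :
  (forall i, B i k = C i k) -> (forall i, B i k != 0 -> x i = y i) ->
  exchange x B k = exchange y C k.
Proof.
move=> BC xy; rewrite /exchange.
congr (_ + _); apply: eq_bigr => i _; rewrite -BC.
  by have [->|/xy->] := eqVneq (B i k) 0.
by have [->|/xy->] := eqVneq (B i k) 0.
Qed.

Lemma mutate_ptN x B k : mutate_pt x (- B) k = mutate_pt x B k.
Proof. by apply/ffunP => i; rewrite !ffunE exchangeN. Qed.

Lemma exchange_gt0 x B k : pos_pt x -> 0 < exchange x B k.
Proof.
move=> x0; rewrite /exchange addr_gt0 //; apply: prodr_gt0 => i _;
  exact: exprz_gt0.
Qed.

Lemma mutate_pt_gt0 x B k : pos_pt x -> pos_pt (mutate_pt x B k).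
Proof.
by move=> x0 i; rewrite ffunE; case: ifP => // _; rewrite divr_gt0 ?exchange_gt0.
Qed.

Lemma mutate_pts_gt0 w x B : pos_pt x -> pos_pt (mutate_pts w x B).
Proof. by elim: w x B => //= k w IH x B x0; apply/IH/mutate_pt_gt0. Qed.

Lemma mutate_ptK x B k : pos_pt x -> B k k = 0 ->
  mutate_pt (mutate_pt x B k) (mutate_mx B k) k = x.
Proof.
move=> x0 Bkk; apply/ffunP => i; rewrite ffunE; case: eqP => [->|/eqP/negPf ik].
  have -> : exchange (mutate_pt x B k) (mutate_mx B k) k = exchange x B k.
    rewrite -(exchangeN x); apply: eq_exchange => j; first by rewrite mutate_mxr mxE.
    rewrite mutate_mxr oppr_eq0 ffunE; case: (j =P k) => // ->.
    by rewrite Bkk eqxx.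
  rewrite ffunE eqxx; have := exchange_gt0 B k x0; have := x0 k.
  by move: (x k) (exchange _ _ _) => a b a0 b0; field; rewrite !gt_eqF.
by rewrite ffunE ik.
Qed.

Definition column B k : {ffun 'I_n -> int} := [ffun i => B i k].
Definition exp_pos e : {ffun 'I_n -> int} := [ffun i => pos_part (e i)].

Lemma exchange_mon x B k : pos_pt x ->
  exchange x B k = mon x (exp_pos (- column B k)) * (1 + mon x (column B k)).
Proof.
move=> x0; rewrite mulrDr mulr1 addrC -monD // /exchange /mon; congr (_ + _).
  apply: eq_bigr => i _; rewrite !ffunE; congr (_ ^ _); rewrite /pos_part.
  by move: (B i k) => z; lia.
by apply: eq_bigr => i _; rewrite !ffunE.
Qed.

Lemma laurent_exchange B k : laurent (fun x => exchange x B k).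
Proof.
apply: (@laurent_ext _ (fun x => mon x (exp_pos (column B k)) +
  mon x (exp_pos (column (- B) k)))).
  by move=> x _; rewrite /exchange /mon; congr (_ + _); apply: eq_bigr => i _;
    rewrite !ffunE ?mxE.
by apply: laurentD; exact: laurent_mon.
Qed.

Lemma laurent_mutate_pt B j i : laurent (fun x => mutate_pt x B j i).
Proof.
apply: (@laurent_ext _ (fun x => if i == j then exchange x B j * mon x (single_exp j (-1))
   else x i)).
  by move=> x _; rewrite ffunE mon_single exprN1.
case: eqP => _; last exact: laurent_var.
by apply: laurentM; [exact: laurent_exchange | exact: laurent_mon].
Qed.

Lemma regular_exchange B j V :
  regular_mod (fun x => 1 + mon x (column B j)) V ->
  regular_mod (fun x => exchange x B j) V.
Proof.
move=> rV; have {}rV := @regular_associate _ _ (exp_pos (- column B j)) _ rV.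
move=> h q lh lq Vh; have [x x0|q' [lq' hq']] := rV h q lh lq.
  by rewrite Vh // exchange_mon.
by exists q'; split=> // x x0; rewrite hq' // exchange_mon.
Qed.

End PointMutation.

(** * The mutation sequence j, k, j *)

Section ThreeMutations.
Variable n : nat.
Implicit Types (B : 'M[int]_n) (i j k : 'I_n) (x : {ffun 'I_n -> rat}).
Implicit Types (P r : {ffun 'I_n -> rat} -> rat).

(** Only the first-order term in [P] is made explicit: it is what survives modulo [P] after a
    division by [P]. *)
Lemma one_addX_expansion P r c : laurent P -> laurent r ->
  exists S, laurent S /\
    forall x, (1 + P x * r x) ^+ c = 1 + P x * (c%:R * r x + P x * S x).
Proof.
move=> lP lr; elim: c => [|c [S [lS E]]].
  exists (fun=> 0); split; first exact: (@laurent_int n 0).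
  by move=> x; rewrite expr0 !(mul0r, mulr0, addr0).
exists (fun x => S x + r x * (c%:~R * r x + P x * S x)); split.
  apply: laurentD => //; apply: laurentM => //; apply: laurentD; last exact: laurentM.
  by apply: laurentM => //; exact: laurent_int.
by move=> x; rewrite exprS E -natr1; ring.
Qed.

Lemma dot_indicator j (e : {ffun 'I_n -> int}) : dot (fun i => (i == j)%:Z) e = e j.
Proof.
rewrite /dot (bigD1 j) //= eqxx mul1r big1 ?addr0 // => i /negPf ij.
by rewrite ij mul0r.
Qed.

(* [mutate2 x B j k] and [mutate3 x B j k] are the new variables of the second
   and third step of the mutation sequence j, k, j. *)
Definition mutate2 B j k x : rat := mutate_pt (mutate_pt x B j) (mutate_mx B j) k k.
Definition mutate3 B j k x : rat := mutate_pts [:: j; k; j] x B j.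

(** The computation is modulo Q = 1 + x^cj. The first new variable is a monomial times Q, so the
    second is a monomial times 1 + Q r. In the third, a factor Q of the exchange polynomial cancels
    the Q of the variable being replaced and leaves 1 + c r modulo Q, up to a monomial. *)
Lemma three_mutations_gt0 B j k : skew_symmetrizable B -> j != k -> 0 < B k j ->
  let P x := exchange x B j in
  [/\ laurent (mutate2 B j k), regular_mod P (mutate2 B j k),
      laurent (mutate3 B j k) & regular_mod P (mutate3 B j k)].
Proof.
move=> sB jk Bkj P.
have kj : k != j by rewrite eq_sym.
have [c Bkj_c] : exists c : nat, B k j = c%:Z by exists `|B k j|%N; rewrite gtz0_abs.
have Bjk : B j k < 0 by rewrite -skew_gt0.
(* The second exchange contains the new variable at [j] to the power [b.+1], hence at least one
   factor Q. *)
have [b Bjk_b] : exists b : nat, B j k = - b.+1%:Z.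
  by exists `|B j k|.-1%N; move: (B j k) Bjk => z; lia.
pose B1 := mutate_mx B j; pose B2 := mutate_mx B1 k.
have sB1 : skew_symmetrizable B1 by exact: skew_mutate.
have sB2 : skew_symmetrizable B2 by exact: skew_mutate.
pose cj := column B j; pose c1 := column B1 k; pose c2 := column B2 j.
have cjj : cj j = 0 by rewrite ffunE skew_diag.
have c1j : c1 j = b.+1%:Z by rewrite ffunE mutate_mxl Bjk_b opprK.
have c1k : c1 k = 0 by rewrite ffunE skew_diag.
have c2j : c2 j = 0 by rewrite ffunE skew_diag.
have c2k : c2 k = c%:Z by rewrite ffunE mutate_mxl mutate_mxr opprK.
pose Q x := 1 + mon x cj.
pose E := exp_pos (- cj) - single_exp j 1.
pose m1 := c1 - single_exp j b.+1%:Z.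
(* [m1] is [c1] without its entry at [j]; there (x^E Q)^(b+1) is substituted, and one factor Q is
   kept outside [r]. *)
pose r x := mon x (m1 + E *+ b.+1) * Q x ^+ b.
have lQ : laurent Q.
  apply: laurentD; [exact: (@laurent_int n 1) | exact: laurent_mon].
have lr : laurent r by apply: laurentM; [exact: laurent_mon | exact: laurentX].
have monMn x e a : pos_pt x -> mon x (e *+ a) = mon x e ^+ a by rewrite pmulrn monMz.
have monB x e f : pos_pt x -> mon x (e - f) = mon x e / mon x f.
  by move=> x0; rewrite monD // monN.
have x1j x : pos_pt x -> mutate_pt x B j j = mon x E * Q x.
  move=> x0; rewrite ffunE eqxx exchange_mon // /E monB // mon_single expr1z.
  by rewrite mulrAC.
have x1i x i : i != j -> mutate_pt x B j i = x i by move=> /negPf ij; rewrite ffunE ij.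
have m2E x : pos_pt x ->
    mutate2 B j k x = mon x (exp_pos (- c1) - single_exp k 1) * (1 + Q x * r x).
  move=> x0; rewrite /mutate2 ffunE eqxx exchange_mon; last exact: mutate_pt_gt0.
  rewrite -/B1 -/c1 x1i // monB // mon_single expr1z mulrAC; congr (_ / _ * (1 + _)).
    apply: eq_mon => i; have [->|ij _] := eqVneq i j; last exact: x1i.
    by rewrite !ffunE -/B1 -[B1 j k]/(B1 j k) mutate_mxl Bjk_b opprK /pos_part; lia.
  rewrite (@mon_update _ x _ j); last by move=> i; exact: x1i.
  rewrite c1j x1j // -/m1 /r monD // monMn // -exprnP exprMn (exprS (Q x)).
  ring.
have [S [lS SE]] := one_addX_expansion c lQ lr.
have m3E x : pos_pt x -> mutate3 B j k x =
    mon x (exp_pos (- c2) - cj - E) * ((1 + c%:R * r x) + Q x * S x).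
  move=> x0; rewrite /mutate3 /= -/B1 -/B2.
  have x10 := mutate_pt_gt0 B j x0.
  have x20 := mutate_pt_gt0 B1 k x10.
  pose U := mutate2 B j k x.
  have x2k : mutate_pt (mutate_pt x B j) B1 k k = U by [].
  have x2i i : i != k -> mutate_pt (mutate_pt x B j) B1 k i = mutate_pt x B j i.
    by move=> /negPf ik; rewrite [LHS]ffunE ik.
  rewrite ffunE eqxx exchange_mon // x2i // x1j // -/c2.
  have -> : mon (mutate_pt (mutate_pt x B j) B1 k) (exp_pos (- c2)) = mon x (exp_pos (- c2)).
    apply: eq_mon => i; have [->|ij] := eqVneq i j.
      by rewrite [exp_pos _ _]ffunE [(- c2) j]ffunE c2j oppr0 eqxx.
    have [->|ik] := eqVneq i k; last by rewrite x2i // x1i.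
    by rewrite [exp_pos _ _]ffunE [(- c2) k]ffunE c2k /pos_part; lia.
  (* The [c]-th power of the monomial in front of [mutate2] cancels what the mutation at [k] adds to
     column [j], so that - cj remains. *)
  have -> : mon (mutate_pt (mutate_pt x B j) B1 k) c2 = mon x (- cj) * (1 + Q x * r x) ^+ c.
    rewrite (@mon_update _ (mutate_pt x B j) _ k); last by move=> i; exact: x2i.
    rewrite x2k c2k -exprnP.
    have -> : mon (mutate_pt x B j) (c2 - single_exp k c) = mon x (c2 - single_exp k c).
      apply: eq_mon => i; have [->|ij _] := eqVneq i j; last by rewrite x1i.
      by rewrite [(c2 - _) j]ffunE [(- single_exp _ _) j]ffunE c2j ffunE (negPf jk) subrr.
    rewrite /U m2E // exprMn mulrA -monMn // -monD //; congr (mon x _ * _).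
    apply/ffunP => i; rewrite !ffunE ffunMnE !ffunE.
    have [->|ik] := eqVneq i k.
      rewrite mutate_mxl mutate_mxr opprK Bkj_c (skew_diag k sB1).
      by rewrite /pos_part oppr0 maxxx sub0r mulNrn; lia.
    have [->|ij] := eqVneq i j.
      rewrite (skew_diag j sB2) (skew_diag j sB) mutate_mxl Bjk_b opprK /pos_part.
      by rewrite max_r ?mul0rn //; lia.
    rewrite mutate_mx_pos_part 1?eq_sym // ?mutate_mxr 1?eq_sym //.
    rewrite Bkj_c !subr0 -mulr_natr /pos_part -/B1.
    by move: (B1 i k) (B i j) => u v; nia.
  rewrite SE !monB // monN; have := mon_neq0 cj x0.
  have Q0 : Q x != 0 by rewrite gt_eqF // addr_gt0 ?mon_gt0.
  have : mon x cj = Q x - 1 by rewrite /Q; ring.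
  move: (mon x cj) (Q x) Q0 => u q q0 uq u0.
  have -> : 1 + u^-1 * (1 + q * (c%:R * r x + q * S x)) =
    u^-1 * (q * ((1 + c%:R * r x) + q * S x)) by rewrite uq in u0 *; field.
  by field; rewrite !mon_neq0 // u0 q0.
have rQ e : regular_mod Q (fun x => mon x e) by exact: regular_mon.
(* For b > 0 this is 1 modulo Q. For b = 0 the weight reading off the exponent of x_j is 0 on [cj]
   and -1 on the monomial of [r]. *)
have rcr : regular_mod Q (fun x => 1 + c%:R * r x).
  have rb a (m : {ffun 'I_n -> int}) : (a = 0%N -> m j != 0) ->
      regular_mod Q (fun x => 1 + c%:R * (mon x m * Q x ^+ a)).
    case: a => [/(_ erefl) mj|a _].
      apply: (@regular_ext _ _ (fun x => 1 + c%:~R * mon x m)).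
        by move=> x _; rewrite mulr1.
      by apply: (@regular_binomial _ _ _ (fun i => (i == j)%:Z)); rewrite dot_indicator.
    apply: (@regular_ext _ _ (fun x => mon x 0 + Q x * (c%:~R * (mon x m * Q x ^+ a)))).
      by move=> x _; rewrite mon0 exprS; ring.
    apply: regular_addM => //; apply: laurentM; first exact: laurent_int.
    by apply: laurentM; [exact: laurent_mon | exact: laurentX].
  apply: rb => b0; rewrite b0 mulr1n [(m1 + E) j]ffunE [m1 j]ffunE c1j b0.
  rewrite [E j]ffunE [exp_pos _ _]ffunE [(- cj) j]ffunE cjj.
  by rewrite !ffunE eqxx /pos_part; lia.
have lm2 : laurent (fun x => mon x (exp_pos (- c1) - single_exp k 1) * (1 + Q x * r x)).
  apply: laurentM; first exact: laurent_mon.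
  by apply: laurentD; [exact: (@laurent_int n 1) | exact: laurentM].
have lV : laurent (fun x => (1 + c%:R * r x) + Q x * S x).
  apply: laurentD; last exact: laurentM.
  apply: laurentD; [exact: (@laurent_int n 1) | apply: laurentM => //].
  exact: (@laurent_int n c).
split.
- by apply: laurent_ext lm2 => x x0; rewrite m2E.
- apply: regular_exchange; apply: (regular_ext (V := fun x => _)) => [x x0|].
    by rewrite m2E.
  apply: regularM => //; last first.
    apply: (@regular_ext _ _ (fun x => mon x 0 + Q x * r x)).
      by move=> x _; rewrite mon0.
    exact: regular_addM.
  by apply: laurentD; [exact: (@laurent_int n 1) | exact: laurentM].
- apply: laurent_ext (laurentM (laurent_mon (exp_pos (- c2) - cj - E)) lV) => x x0.
  by rewrite m3E.
- apply: regular_exchange; apply: (regular_ext (V := fun x => _)) => [x x0|].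
    by rewrite m3E.
  by apply: regularM => //; apply: regular_addM.
Qed.

End ThreeMutations.

Section LaurentPhenomenon.
Variable n : nat.
Implicit Types (B : 'M[int]_n) (i j k : 'I_n) (x : {ffun 'I_n -> rat}).
Implicit Types (P V y : {ffun 'I_n -> rat} -> rat) (w : seq 'I_n).

(** The two mutations commute: the third new variable is x_j again and the second is P_k / x_k. The
    minor serves to make P_k regular modulo P_j. *)
Lemma three_mutations_eq0 B j k :
  skew_symmetrizable B -> j != k -> B k j = 0 ->
  (exists p q, B p j * B q k != B q j * B p k) ->
  let P x := exchange x B j in
  [/\ laurent (mutate2 B j k), regular_mod P (mutate2 B j k),
      laurent (mutate3 B j k) & regular_mod P (mutate3 B j k)].
Proof.
move=> sB jk Bkj [p [q pq]] P.
have kj : k != j by rewrite eq_sym.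
have Bjk : B j k = 0 by apply/eqP; rewrite skew_eq0 // Bkj.
pose B1 := mutate_mx B j; pose B2 := mutate_mx B1 k.
have B1k i : B1 i k = B i k.
  have [->|ij] := eqVneq i j; first by rewrite mutate_mxl Bjk oppr0.
  by rewrite mutate_mx_pos_part // Bjk /pos_part maxxx !mulr0 !addr0.
have B2j i : B2 i j = (- B) i j.
  rewrite [RHS]mxE; have [->|ik] := eqVneq i k.
    by rewrite mutate_mxl mutate_mxr Bkj !oppr0.
  rewrite mutate_mx_pos_part // !mutate_mxr Bkj oppr0 /pos_part maxxx.
  by rewrite !mulr0 !addr0.
have m2E x : pos_pt x ->
    mutate2 B j k x = exchange x B k * mon x (single_exp k (-1)).
  move=> x0; rewrite /mutate2 ffunE eqxx mon_single exprN1; congr (_ / _).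
    apply: eq_exchange => // i; rewrite B1k ffunE; case: (i =P j) => // ->.
    by rewrite Bjk eqxx.
  by rewrite ffunE (negPf kj).
have m3E x : pos_pt x -> mutate3 B j k x = x j.
  move=> x0; rewrite /mutate3 /= -/B1 -/B2 ffunE eqxx.
  have -> : exchange (mutate_pt (mutate_pt x B j) B1 k) B2 j = exchange x B j.
    rewrite -(exchangeN x); apply: eq_exchange => // i; rewrite B2j mxE oppr_eq0.
    have [->|ik] := eqVneq i k; first by rewrite Bkj eqxx.
    have [->|ij _] := eqVneq i j; first by rewrite skew_diag ?eqxx.
    by rewrite ffunE (negPf ik) ffunE (negPf ij).
  rewrite ffunE (negPf jk) ffunE eqxx.
  have := exchange_gt0 B j x0; have := x0 j; move: (x j) (exchange x B j).
  by move=> u v u0 v0; field; rewrite !gt_eqF.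
split.
- apply: laurent_ext (laurentM (laurent_exchange B k) (laurent_mon (single_exp k (-1)))) => x x0.
  by rewrite m2E.
- apply: regular_exchange.
  apply: (@regular_ext _ _ (fun x => mon x (exp_pos (- column B k) + single_exp k (-1)) *
     (1 + 1%:~R * mon x (column B k)))).
    by move=> x x0; rewrite m2E // exchange_mon // monD // mul1r; ring.
  have l1 : laurent (fun x => 1 + 1%:~R * mon x (column B k)).
    apply: laurentD; first exact: (@laurent_int n 1).
    by apply: laurentM; [exact: laurent_int | exact: laurent_mon].
  apply: regularM => //; first exact: regular_mon.
  (* A weight supported on [p] and [q] that is orthogonal to column [j]; on column [k] its value is
     the nonzero minor. *)
  pose f i : int := B p j * (i == q)%:Z - B q j * (i == p)%:Z.
  have fE (e : {ffun 'I_n -> int}) : dot f e = B p j * e q - B q j * e p.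
    rewrite -(dot_indicator q) -(dot_indicator p) /dot !mulr_sumr -sumrB.
    by apply: eq_bigr => i _; rewrite /f; ring.
  apply: (regular_binomial (p := f)); rewrite fE !ffunE; first by ring.
  by rewrite subr_eq0.
- by apply: laurent_ext (laurent_var j) => x x0; rewrite m3E.
- apply: (@regular_ext _ _ (fun x => mon x (single_exp j 1))).
    by move=> x x0; rewrite m3E // mon_single expr1z.
  exact: regular_mon.
Qed.

(** The negative case reduces to the positive one by passing to - B, which has the same exchange
    polynomials. *)
Lemma three_mutations B j k :
  skew_symmetrizable B -> j != k ->
  (exists p q, B p j * B q k != B q j * B p k) ->
  let P x := exchange x B j in
  [/\ laurent (mutate2 B j k), regular_mod P (mutate2 B j k),
      laurent (mutate3 B j k) & regular_mod P (mutate3 B j k)].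
Proof.
move=> sB jk minor; case: (ltgtP (B k j) 0) => Bkj.
- have [||] := @three_mutations_gt0 _ (- B) j k _ jk; first exact: skewN.
    by rewrite mxE oppr_gt0.
  have E2 x : mutate2 (- B) j k x = mutate2 B j k x.
    by rewrite /mutate2 mutate_mxN !mutate_ptN.
  have E3 x : mutate3 (- B) j k x = mutate3 B j k x.
    by rewrite /mutate3 /= !mutate_mxN !mutate_ptN.
  have EP V : regular_mod (fun x => exchange x (- B) j) V ->
      regular_mod (fun x => exchange x B j) V.
    move=> rV h q lh lq Vh; have [x x0|q' [lq' hq']] := rV h q lh lq.
      by rewrite Vh // exchangeN.
    by exists q'; split=> // x x0; rewrite hq' // exchangeN.
  move=> l2 /EP r2 l3 /EP r3; split.
  + by apply: laurent_ext l2.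
  + by apply: regular_ext r2.
  + by apply: laurent_ext l3.
  + by apply: regular_ext r3.
- exact: three_mutations_gt0.
- exact: three_mutations_eq0.
Qed.

(** Since [V] is regular modulo [P], the factors of P^a can be cancelled one at a time. *)
Lemma laurent_divide y P V a :
  (forall x, pos_pt x -> P x != 0) -> laurent P -> regular_mod P V ->
  laurent (fun x => y x * P x ^+ a) -> laurent (fun x => y x * V x) -> laurent y.
Proof.
move=> P0 lP rV la lV; elim: a la => [|a IH] la.
  by apply: laurent_ext la => x _; rewrite expr0 mulr1.
have [x x0|q' [lq' hq']] := rV _ _ la (laurentM (laurentX a lP) lV).
  by rewrite exprS; ring.
apply: IH; apply: laurent_ext lq' => x x0.
by apply: (mulfI (P0 x x0)); rewrite -hq' // exprS; ring.
Qed.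

Theorem laurent_phenomenon (M : {pred 'I_n}) B w i :
  skew_symmetrizable B -> cols_free M B -> {subset w <= M} ->
  laurent (fun x => mutate_pts w x B i).
Proof.
have [d] := ubnP (size w); elim: d w B => // d IH [|j [|k w]] B.
- by move=> _ _ _ _; exact: laurent_var.
- by move=> _ _ _ _; exact: laurent_mutate_pt.
rewrite /= !ltnS => wd sB fB wM.
have jM : j \in M by apply: wM; rewrite inE eqxx.
have kM : k \in M by apply: wM; rewrite !inE eqxx orbT.
have kwM : {subset k :: w <= M} by move=> l lw; apply: wM; rewrite inE lw orbT.
have {}wM : {subset w <= M} by move=> l lw; apply: kwM; rewrite inE lw orbT.
have [<-|jk] := eqVneq j k.
  apply: laurent_ext (IH w B _ sB fB wM) => [x x0|]; last by lia.
  by rewrite mutate_ptK ?mutate_mxK ?skew_diag.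
pose B1 := mutate_mx B j; pose B2 := mutate_mx B1 k; pose B3 := mutate_mx B2 j.
have sB1 : skew_symmetrizable B1 by exact: skew_mutate.
have fB1 : cols_free M B1 by apply: cols_free_mutate => //; rewrite skew_diag.
have sB2 : skew_symmetrizable B2 by exact: skew_mutate.
have fB2 : cols_free M B2 by apply: cols_free_mutate => //; rewrite skew_diag.
have sB3 : skew_symmetrizable B3 by exact: skew_mutate.
have fB3 : cols_free M B3 by apply: cols_free_mutate => //; rewrite skew_diag.
have [l2 r2 l3 r3] := three_mutations sB jk (cols_free_minor fB jM kM jk).
pose u1 x := mutate_pt x B j.
pose u2 x := mutate_pt (u1 x) B1 k.
pose u3 x := mutate_pt (u2 x) B2 j.
have u10 x : pos_pt x -> pos_pt (u1 x) by exact: mutate_pt_gt0.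
have u20 x : pos_pt x -> pos_pt (u2 x) by move=> x0; exact/mutate_pt_gt0/u10.
have u30 x : pos_pt x -> pos_pt (u3 x) by move=> x0; exact/mutate_pt_gt0/u20.
pose y x := mutate_pts w (u2 x) B2 i.
rewrite -[laurent _]/(laurent y).
(* First denominator: [k :: w], started at t1, is shorter than the given sequence. *)
have [a la] : exists a, laurent (fun x => y x * (\prod_l u1 x l) ^+ a).
  apply: (laurent_subst (g := fun x => mutate_pts (k :: w) x B1 i)) => //.
  - by apply: IH.
  - by move=> l; exact: laurent_mutate_pt.
have lr3 l : laurent (fun x => u3 x l) /\ regular_mod (fun x => exchange x B j) (fun x => u3 x l).
  have [->|lj] := eqVneq l j; first by split.
  have u3l x : u3 x l = if l == k then mutate2 B j k x else mon x (single_exp l 1).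
    rewrite ffunE (negPf lj); case: eqP => [->//|/eqP/negPf lk].
    by rewrite ffunE lk ffunE (negPf lj) mon_single expr1z.
  split; [apply: laurent_ext (fun x _ => esym (u3l x)) _ |
          apply: regular_ext (fun x _ => esym (u3l x)) _]; case: eqP => _ //.
  - exact: laurent_mon.
  - exact: regular_mon.
(* Second denominator: mutating [u3] at [j] leads back to [u2], so [j :: w], started at t3, computes
   [y] as well. *)
have [c lc] : exists c, laurent (fun x => y x * (\prod_l u3 x l) ^+ c).
  have yE x : pos_pt x -> mutate_pts (j :: w) (u3 x) B3 i = y x.
    by move=> x0; rewrite /= mutate_ptK ?mutate_mxK ?skew_diag //; apply: u20.
  have [||l|c lc] := @laurent_subst _ (fun x => mutate_pts (j :: w) x B3 i) u3.
  - by apply: IH => // l; rewrite inE => /predU1P[->|/wM].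
  - exact: u30.
  - by have [] := lr3 l.
  by exists c; apply: laurent_ext lc => x x0; rewrite yE.
(* The first denominator is a power of P_j up to a monomial; the entry -1 comes from the division by
   x_j in the new variable. *)
pose e : {ffun 'I_n -> int} := [ffun l => if l == j then -1 else 1].
have u1E x : pos_pt x -> \prod_l u1 x l = mon x e * exchange x B j.
  move=> x0; rewrite (bigD1 j) //= /mon [in RHS](bigD1 j) //= !ffunE eqxx exprN1.
  rewrite [RHS]mulrC mulrA; congr (_ * _); apply: eq_bigr => l /negPf lj.
  by rewrite !ffunE lj expr1z.
apply: (@laurent_divide y (fun x => exchange x B j) _ a _ _ _ _ lc).
- by move=> x x0; rewrite gt_eqF ?exchange_gt0.
- exact: laurent_exchange.
- apply: regularX; first by apply: laurent_prod => l; have [] := lr3 l.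
  by apply: regular_prod => l; have [] := lr3 l.
apply: laurent_ext (laurentM la (laurent_mon (- (e *~ a)))) => x x0.
rewrite u1E // monN monMz -exprnP exprMn; field.
by rewrite expf_neq0 ?mon_neq0.
Qed.

End LaurentPhenomenon.

(** * The ring Z[1/2] *)

Definition dyadic : {pred rat} :=
  fun r => `[< exists (a : nat) (m : int), r * 2 ^+ a = m%:~R >].

Lemma dyadicP r :
  reflect (exists (a : nat) (m : int), r * 2 ^+ a = m%:~R) (r \in dyadic).
Proof. exact: asboolP. Qed.

Lemma dyadic_subring : subring_closed dyadic.
Proof.
split=> [|r s /dyadicP[a [m rE]] /dyadicP[b [k sE]]|
          r s /dyadicP[a [m rE]] /dyadicP[b [k sE]]]; apply/dyadicP.
- by exists 0%N, 1; rewrite mulr1.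
- exists (a + b)%N, (m * 2 ^+ b - k * 2 ^+ a).
  by rewrite rmorphB !rmorphM /= -rE -sE exprD !rmorphXn /=; ring.
- by exists (a + b)%N, (m * k); rewrite rmorphM /= -rE -sE exprD; ring.
Qed.

HB.instance Definition _ := GRing.isSubringClosed.Build rat dyadic dyadic_subring.

Lemma dyadic_exp2 (z : int) : (2 : rat) ^ z \in dyadic.
Proof.
apply/dyadicP; case: z => a; first by exists 0%N, (2 ^+ a); rewrite mulr1 rmorphXn.
exists a.+1, 1; rewrite NegzE -exprnN mulVf // expf_neq0 //.
Qed.

(** * Frozen variables and values at powers of 2 *)

Section FrozenVariables.
Variable n : nat.
Implicit Types (B : 'M[int]_n) (C : 'M[int]_(n + n)) (x : {ffun 'I_n -> rat}).

(** Principal coefficients, written as a square matrix so that the same mutation rule applies. The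
    lower left identity makes the first [n] columns independent; the block above the zero block
    restores skew-symmetrizability. *)
Definition frozen_mx B : 'M[int]_(n + n) := block_mx B (- 1%:M) 1%:M 0.
Definition frozen_pt x : {ffun 'I_(n + n) -> rat} :=
  [ffun i => if split i is inl a then x a else 1].

Lemma frozen_pt_l x i : frozen_pt x (lshift n i) = x i.
Proof. by rewrite ffunE (unsplitK (inl i)). Qed.

Lemma frozen_pt_r x i : frozen_pt x (rshift n i) = 1.
Proof. by rewrite ffunE (unsplitK (inr i)). Qed.

Lemma skew_frozen B : skew_symmetrizable B -> skew_symmetrizable (frozen_mx B).
Proof.
move/skew_symmetrizableP => [d [d0 Bd]]; apply/skew_symmetrizableP.
exists (fun i => match split i with inl a => d a | inr a => d a end).
split=> [i|i j]; first by case: split => a.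
case: (split_ordP i) => a ->; case: (split_ordP j) => b ->;
  rewrite ?block_mxEul ?block_mxEur ?block_mxEdl ?block_mxEdr
    ?(unsplitK (inl a)) ?(unsplitK (inl b)) ?(unsplitK (inr a)) ?(unsplitK (inr b))
    ?mxE ?mul0r ?oppr0 //.
- by rewrite eq_sym; case: eqP => [->|_]; rewrite ?mulN1r ?mul1r ?mul0r ?oppr0 ?mul0r.
- by rewrite eq_sym; case: eqP => [->|_]; rewrite ?mulN1r ?mul1r ?mul0r ?oppr0 ?mul0r ?opprK.
Qed.

Lemma cols_free_frozen B :
  cols_free [pred i | i \in codom (lshift n)] (frozen_mx B).
Proof.
move=> c cM Bc j; have [|jM] := boolP (j \in codom (lshift n)); last exact: cM.
move=> /codomP[a ->]; have := Bc (rshift n a); rewrite big_split_ord /=.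
rewrite (bigD1 a) //= block_mxEdl mxE eqxx mul1r !big1 ?addr0 // => i.
  by rewrite block_mxEdr mxE mul0r.
by move=> /negPf ia; rewrite block_mxEdl mxE eq_sym ia mul0r.
Qed.

Lemma mutate_frozen_pt x C k :
  mutate_pt (frozen_pt x) C (lshift n k) = frozen_pt (mutate_pt x (ulsubmx C) k).
Proof.
have -> : mutate_pt (frozen_pt x) C (lshift n k) = [ffun i => if i == lshift n k
    then exchange x (ulsubmx C) k / x k else frozen_pt x i].
  apply/ffunP => i; rewrite [LHS]ffunE [RHS]ffunE; case: eqP => // _; rewrite frozen_pt_l.
  congr (_ / _); rewrite /exchange !big_split_ord /=.
  rewrite [X in _ * X + _]big1 => [|j _]; last by rewrite frozen_pt_r exp1rz.
  rewrite [X in _ + _ * X]big1 => [|j _]; last by rewrite frozen_pt_r exp1rz.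
  by rewrite !mulr1; congr (_ + _); apply: eq_bigr => j _; rewrite frozen_pt_l !mxE.
apply/ffunP => i; rewrite ffunE; case: (split_ordP i) => a ->.
  by rewrite !frozen_pt_l ffunE eq_shift.
by rewrite !frozen_pt_r eq_shift.
Qed.

Lemma ulsubmx_mutate C k :
  ulsubmx (mutate_mx C (lshift n k)) = mutate_mx (ulsubmx C) k.
Proof. by apply/matrixP => i j; rewrite !mxE !eq_shift. Qed.

Lemma mutate_frozen_pts w x C :
  mutate_pts (map (lshift n) w) (frozen_pt x) C = frozen_pt (mutate_pts w x (ulsubmx C)).
Proof.
elim: w x C => //= k w IH x C.
by rewrite mutate_frozen_pt IH ulsubmx_mutate.
Qed.

Lemma mutate_pts_dyadic B w x (u : 'I_n -> int) i :
  skew_symmetrizable B -> (forall j, x j = 2 ^ u j) ->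
  mutate_pts w x B i \in dyadic.
Proof.
move=> sB xu.
have [|l lE] := @laurent_phenomenon _ _ (frozen_mx B) (map (lshift n) w) (lshift n i)
  (skew_frozen sB) (@cols_free_frozen B).
  by move=> j /mapP[k _ ->]; rewrite inE codom_f.
have x0 : pos_pt (frozen_pt x).
  move=> j; case: (split_ordP j) => a ->; rewrite ?frozen_pt_r //.
  by rewrite frozen_pt_l xu exprz_gt0.
have := lE _ x0; rewrite mutate_frozen_pts frozen_pt_l block_mxKul => ->.
apply: rpred_sum => t _; apply: rpredM; first exact: rpred_int.
apply: rpred_prod => j _; case: (split_ordP j) => a ->.
  by rewrite frozen_pt_l xu exprz_exp dyadic_exp2.
by rewrite frozen_pt_r exp1rz rpred1.
Qed.

End FrozenVariables.

(** * Values of rational functions in the initial cluster *)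

Section MutationSequences.
Variable n : nat.
Implicit Types (B : 'M[int]_n) (w : seq 'I_n) (s : seed_data n).

Definition mutate_mxs w B : 'M[int]_n := foldl (@mutate_mx n) B w.
Definition mutates w s : seed_data n := foldl (@mutate n) s w.

Lemma seed_mx_mutates w s : seed_mx (mutates w s) = mutate_mxs w (seed_mx s).
Proof. by elim: w s => //= k w IH s; rewrite IH. Qed.

Lemma mutates_cat w w' s : mutates (w ++ w') s = mutates w' (mutates w s).
Proof. exact: foldl_cat. Qed.

Lemma reachable_mutatesP s0 s :
  mutation_reachable s0 s <-> exists w, s = mutates w s0.
Proof.
split=> [|[w ->]].
  elim=> [|_ k _ [w ->]]; first by exists [::].
  by exists (rcons w k); rewrite /mutates foldl_rcons.
elim/last_ind: w => [|w k IH]; first exact: reach_init.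
by rewrite /mutates foldl_rcons; exact: reach_mutate.
Qed.

Lemma skew_mutates w B : skew_symmetrizable B -> skew_symmetrizable (mutate_mxs w B).
Proof. by elim: w B => //= k w IH B sB; apply/IH/skew_mutate. Qed.

Lemma mutate_mxs_rev w B : mutate_mxs (rev w) (mutate_mxs w B) = B.
Proof.
elim: w B => //= k w IH B.
by rewrite rev_cons /mutate_mxs foldl_rcons -!/(mutate_mxs _ _) IH mutate_mxK.
Qed.

Lemma mutate_pts_cat w w' x B :
  mutate_pts (w ++ w') x B = mutate_pts w' (mutate_pts w x B) (mutate_mxs w B).
Proof. by elim: w x B => //= k w IH x B; rewrite IH. Qed.

Lemma mutate_pts_rev w x B : pos_pt x -> skew_symmetrizable B ->
  mutate_pts (rev w) (mutate_pts w x B) (mutate_mxs w B) = x.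
Proof.
elim: w x B => //= k w IH x B x0 sB.
rewrite rev_cons -cats1 mutate_pts_cat IH; [|exact: mutate_pt_gt0|exact: skew_mutate].
by rewrite mutate_mxs_rev /= mutate_ptK // skew_diag.
Qed.

End MutationSequences.

Section Values.
Variables (n : nat) (g : 'I_n -> ambient n).
Hypothesis indep : forall p : {mpoly rat[n]}, ambient_eval g p = 0 -> p = 0.
Variable v : {ffun 'I_n -> rat}.
Implicit Types (p q : {mpoly rat[n]}) (y z : ambient n) (r s : rat).

(** Named so that it can carry a ring morphism structure, through which [ambient_eval] inherits the
    morphism laws of [mmap]. *)
Definition coef_embed (c : rat) : ambient n := tofrac (mpolyC n c).

HB.instance Definition _ := GRing.RMorphism.copy coef_embed
  (@tofrac {mpoly rat[n]} \o @mpolyC n rat).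

Lemma ambient_evalE p : ambient_eval g p = mmap coef_embed g p.
Proof. by []. Qed.

Lemma ambient_evalM p q : ambient_eval g (p * q) = ambient_eval g p * ambient_eval g q.
Proof. by rewrite !ambient_evalE rmorphM. Qed.

Lemma ambient_evalD p q : ambient_eval g (p + q) = ambient_eval g p + ambient_eval g q.
Proof. by rewrite !ambient_evalE rmorphD. Qed.

Lemma ambient_evalN p : ambient_eval g (- p) = - ambient_eval g p.
Proof. by rewrite !ambient_evalE rmorphN. Qed.

Lemma ambient_eval1 : ambient_eval g 1 = 1.
Proof. by rewrite ambient_evalE rmorph1. Qed.

Lemma ambient_evalX i : ambient_eval g 'X_i = g i.
Proof. by rewrite ambient_evalE mmapX mmap1U. Qed.

(* [value_at y r]: the rational function y of the generators g is regular at v,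
   where it takes the value r. *)
Definition value_at y r : Prop :=
  exists p q, [/\ q.@[v] != 0, y * ambient_eval g q = ambient_eval g p
                & r = p.@[v] / q.@[v]].

(** Two fractions for the same element agree after cross-multiplication as polynomials, by algebraic
    independence, hence also at [v]. *)
Lemma value_uniq y r s : value_at y r -> value_at y s -> r = s.
Proof.
move=> [p [q [q0 yp ->]]] [p' [q' [q'0 yp' ->]]].
have /indep/eqP : ambient_eval g (p * q' - p' * q) = 0.
  by rewrite ambient_evalD ambient_evalN !ambient_evalM -yp -yp'; ring.
rewrite subr_eq0 => /eqP/(congr1 (meval v)); rewrite !mevalM => E.
by apply/eqP; rewrite eqr_div // E.
Qed.

Lemma value_gen i : value_at (g i) (v i).
Proof.
exists 'X_i, 1; rewrite meval1 oner_eq0 ambient_eval1 ambient_evalX mulr1.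
by rewrite mevalXU divr1.
Qed.

Lemma value1 : value_at 1 1.
Proof. by exists 1, 1; rewrite meval1 oner_eq0 divr1 mul1r. Qed.

Lemma valueD y z r s : value_at y r -> value_at z s -> value_at (y + z) (r + s).
Proof.
move=> [p [q [q0 yp ->]]] [p' [q' [q'0 yp' ->]]].
exists (p * q' + p' * q), (q * q'); rewrite !(mevalM, mevalD) mulf_neq0 //.
split=> //; last by field; rewrite q0 q'0.
by rewrite !(ambient_evalM, ambient_evalD) -yp -yp'; ring.
Qed.

Lemma valueM y z r s : value_at y r -> value_at z s -> value_at (y * z) (r * s).
Proof.
move=> [p [q [q0 yp ->]]] [p' [q' [q'0 yp' ->]]].
exists (p * p'), (q * q'); rewrite !mevalM mulf_neq0 //.
split=> //; last by field; rewrite q0 q'0.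
by rewrite !ambient_evalM -yp -yp'; ring.
Qed.

Lemma valueN y r : value_at y r -> value_at (- y) (- r).
Proof.
move=> [p [q [q0 yp ->]]]; exists (- p), q; rewrite mevalN ambient_evalN mulNr.
by rewrite yp mulNr.
Qed.

Lemma value_neq0 y r : value_at y r -> r != 0 -> y != 0.
Proof.
move=> [p [q [q0 yp ->]]]; apply: contraNneq => y0.
by move: yp; rewrite y0 mul0r => /esym/indep->; rewrite meval0 mul0r.
Qed.

Lemma valueV y r : r != 0 -> value_at y r -> value_at y^-1 r^-1.
Proof.
move=> r0 yr; have y0 := value_neq0 yr r0; move: yr r0.
move=> [p [q [q0 yp ->]]]; rewrite mulf_eq0 invr_eq0 (negPf q0) orbF => p0.
by exists q, p; rewrite p0 -yp mulKf // invf_div.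
Qed.

Lemma valueXz y r (z : int) : 0 < r -> value_at y r -> value_at (y ^ z) (r ^ z).
Proof.
move=> r0 yr; have X a : value_at (y ^+ a) (r ^+ a).
  elim: a => [|a IH]; first exact: value1.
  by rewrite !exprS; exact: valueM.
case: z => a; first exact: X.
by rewrite NegzE -!exprnN; apply: valueV => //; rewrite expf_neq0 ?gt_eqF.
Qed.

Lemma value_prod (F : 'I_n -> ambient n) (f : 'I_n -> rat) :
  (forall i, value_at (F i) (f i)) -> value_at (\prod_i F i) (\prod_i f i).
Proof.
move=> Ff; elim/big_ind2: _ => //; first exact: value1.
by move=> y1 r1 y2 r2; exact: valueM.
Qed.

Lemma value_exchange (X : 'I_n -> ambient n) (x : {ffun 'I_n -> rat}) B k :
  pos_pt x -> (forall i, value_at (X i) (x i)) ->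
  value_at (exchange X B k) (exchange x B k).
Proof.
by move=> x0 Xx; apply: valueD; apply: value_prod => i; apply: valueXz.
Qed.

Lemma value_mutate (s : seed_data n) (x : {ffun 'I_n -> rat}) k :
  pos_pt x -> (forall i, value_at (seed_var s i) (x i)) ->
  forall i, value_at (seed_var (mutate s k) i) (mutate_pt x (seed_mx s) k i).
Proof.
move=> x0 sx i; rewrite !ffunE; case: eqP => // _.
apply: valueM; first exact: value_exchange.
by apply: valueV => //; rewrite gt_eqF.
Qed.

Lemma value_mutates w (s : seed_data n) (x : {ffun 'I_n -> rat}) :
  pos_pt x -> (forall i, value_at (seed_var s i) (x i)) ->
  forall i, value_at (seed_var (mutates w s) i) (mutate_pts w x (seed_mx s) i).
Proof.
elim: w s x => //= k w IH s x x0 sx i.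
by apply: IH; [exact: mutate_pt_gt0 | exact: value_mutate].
Qed.

End Values.

(** Modulo 2^a + 1 the power 2^a is -1, so lowering b by a exchanges the two signs; the descent
    therefore carries both. Below a only b = 0 is left, with 2^0 - 1 = 0. *)
Lemma exp2D1_dvd (a b : nat) : (0 < a)%N ->
  (2 ^ a + 1 %| 2 ^ b + 1)%N || (2 ^ a + 1 %| 2 ^ b - 1)%N -> (a %| b)%N.
Proof.
move=> a0; have [d] := ubnP b; elim: d b => // d IH b bd.
case: (ltnP b a) => [ba|ab].
  have lt2 : (2 ^ b < 2 ^ a)%N by rewrite ltn_exp2l.
  case/orP => [/dvdn_leq|]; first by rewrite addn1 => /(_ isT); lia.
  case: b {bd} ba lt2 => [|b] ba lt2; first by rewrite dvdn0.
  have : (1 < 2 ^ b.+1)%N by rewrite -{1}(expn0 2) ltn_exp2l.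
  by move=> b1 /dvdn_leq; lia.
have E : (2 ^ b = 2 ^ (b - a) * (2 ^ a + 1) - 2 ^ (b - a))%N.
  by rewrite mulnDr muln1 addnK -expnD subnK.
have P : (0 < 2 ^ (b - a))%N by rewrite expn_gt0.
have le : (2 ^ (b - a) <= 2 ^ (b - a) * (2 ^ a + 1))%N by rewrite leq_pmulr // addn1.
move=> dvd; rewrite -(subnK ab) dvdn_addl //; apply: IH; first by lia.
have dM : (2 ^ a + 1 %| 2 ^ (b - a) * (2 ^ a + 1))%N by exact: dvdn_mull.
case/orP: dvd => dvd; apply/orP; [right|left].
  rewrite -(dvdn_addr _ dvd); have -> : (2 ^ b + 1 + (2 ^ (b - a) - 1) =
    2 ^ (b - a) * (2 ^ a + 1))%N by lia.
  exact: dM.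
have B : (0 < 2 ^ b)%N by rewrite expn_gt0.
rewrite -(dvdn_addr _ dvd); have -> : (2 ^ b - 1 + (2 ^ (b - a) + 1) =
  2 ^ (b - a) * (2 ^ a + 1))%N by lia.
exact: dM.
Qed.

(** Up to a power of 2, a unit of Z[1/2], 1 + 2^z is 2^|z| + 1. For m nonzero 2^|m| + 1 is odd, so
    powers of 2 drop out of the divisibility; being larger than 2, it excludes k = 0. *)
Lemma dyadic_exp2D1_dvd (r : rat) (m k : int) : r \in dyadic -> m != 0 ->
  r * (1 + 2 ^ m) = 1 + 2 ^ k -> k != 0 /\ (m %| k)%Z.
Proof.
have absE (z : int) : exists u : int, (1 + 2 ^ z : rat) = 2 ^ u * (2 ^+ `|z|%N + 1).
  case: z => a; first by exists 0; rewrite expr0z mul1r addrC.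
  exists (Negz a); rewrite NegzE -exprnN abszN absz_nat mulrDr mulVf ?mulr1 //.
  by rewrite expf_neq0.
move=> dr m0; have [u ->] := absE m; have [u' ->] := absE k => E.
have : r * 2 ^ (u - u') \in dyadic by rewrite rpredM ?dyadic_exp2.
case/dyadicP => c [z zE].
have {}E : r * 2 ^ (u - u') * (2 ^+ `|m|%N + 1) = 2 ^+ `|k|%N + 1.
  apply: (mulfI (_ : (2 : rat) ^ u' != 0)); first by rewrite expfz_neq0.
  rewrite -E expfzDr //; have := @expfz_neq0 rat 2 u' isT.
  by rewrite -invr_expz; move=> u0; field.
have {}zE : z * (2 ^+ `|m|%N + 1) = 2 ^+ c * (2 ^+ `|k|%N + 1).
  apply: (@intr_inj rat); rewrite !rmorphM !rmorphD !rmorphXn /= -zE -E; ring.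
have dvd : (2 ^ `|m| + 1 %| 2 ^ c * (2 ^ `|k| + 1))%N.
  apply/dvdnP; exists `|z|%N; apply/eqP; rewrite -eqz_nat.
  move/(congr1 absz): zE; rewrite !abszM => zE.
  have pE a : `|(2 ^+ a + 1 : int)%R|%N = (2 ^ a + 1)%N.
    by rewrite -[RHS]/(absz (Posz (2 ^ a + 1))) PoszD -(natz (2 ^ a)) natrX.
  by rewrite !pE abszX in zE; rewrite -zE.
have m1 : (0 < `|m|)%N by rewrite absz_gt0.
have {}dvd : (2 ^ `|m| + 1 %| 2 ^ `|k| + 1)%N.
  rewrite -(Gauss_dvdr _ (_ : coprime _ (2 ^ c))) //.
  rewrite coprimeXr // coprimen2 oddD oddX; by case: `|m|%N m1.
split.
  apply: contraTneq dvd => ->; rewrite absz0 expn0 gtnNdvd //.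
  by rewrite ltn_add2r -{1}(expn0 2) ltn_exp2l.
by rewrite dvdzE; apply: exp2D1_dvd => //; rewrite dvd.
Qed.

Lemma mon_exp2 n (x : {ffun 'I_n -> rat}) (u : 'I_n -> int) (e : {ffun 'I_n -> int}) :
  (forall i, x i = 2 ^ u i) -> mon x e = 2 ^ dot u e.
Proof.
move=> xu; rewrite /mon /dot.
rewrite (big_morph (fun z : int => (2 : rat) ^ z) (id1 := 1) (op1 := *%R)).
- by apply: eq_bigr => i _; rewrite xu exprz_exp.
- by move=> a b; rewrite expfzDr.
- by rewrite expr0z.
Qed.

(** * Comparing columns through values at powers of 2 *)

Section ColumnComparison.
Variables (n : nat) (s0 : seed_data n).
Hypothesis s0_seed : is_labeled_seed s0.

Let indep : forall p, ambient_eval (seed_var s0) p = 0 -> p = 0 := s0_seed.1.1.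
Let skew0 : skew_symmetrizable (seed_mx s0) := s0_seed.2.
Let val v := value_at (seed_var s0) v.

(** The point [x] is given to the seed reached by [w]; mutating back yields the point [v] of the
    initial seed. Elements with a dyadic value at [v] form a subring, and it contains every cluster
    variable. *)
Lemma cluster_algebra_dyadic w (x : {ffun 'I_n -> rat}) (u : 'I_n -> int) y :
  (forall i, x i = 2 ^ u i) -> y \in cluster_algebra_pred s0 ->
  exists r, r \in dyadic /\
    val (mutate_pts (rev w) x (mutate_mxs w (seed_mx s0))) y r.
Proof.
move=> xu yA; set v := mutate_pts _ _ _.
have x0 : pos_pt x by move=> i; rewrite xu exprz_gt0.
pose S : {pred ambient n} := fun y => `[< exists r, r \in dyadic /\ val v y r >].
suff /asboolP : y \in S by [].
move/cluster_algebra_predP: yA; apply.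
  split=> [|y1 y2 /asboolP[r1 [d1 v1]] /asboolP[r2 [d2 v2]]|
           y1 y2 /asboolP[r1 [d1 v1]] /asboolP[r2 [d2 v2]]]; apply/asboolP.
  - by exists 1; split; [exact: rpred1 | exact: value1].
  - exists (r1 - r2); split; first exact: rpredB.
    by apply: valueD => //; exact: valueN.
  - by exists (r1 * r2); split; [exact: rpredM | exact: valueM].
move=> _ [s [k [/reachable_mutatesP[w' ->] ->]]]; apply/asboolP.
have v0 : pos_pt v by exact: mutate_pts_gt0.
exists (mutate_pts w' v (seed_mx s0) k); split; last first.
  by apply: value_mutates => // i; exact: value_gen.
have -> : mutate_pts w' v (seed_mx s0) =
    mutate_pts (rev w ++ w') x (mutate_mxs w (seed_mx s0)).
  by rewrite mutate_pts_cat mutate_mxs_rev.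
by apply: mutate_pts_dyadic xu; exact: skew_mutates.
Qed.

Lemma exchange_column_dvd w l (C : 'M[int]_n) y (u : 'I_n -> int) :
  let t := mutates w s0 in
  C l l = 0 -> y \in cluster_algebra_pred s0 ->
  y * seed_var t l = exchange (seed_var t) C l ->
  dot u (column (seed_mx t) l) != 0 ->
  dot u (column C l) != 0 /\ (dot u (column (seed_mx t) l) %| dot u (column C l))%Z.
Proof.
move=> t Cll yA yE m0.
pose x : {ffun 'I_n -> rat} := [ffun i => 2 ^ u i].
have xu i : x i = 2 ^ u i by rewrite ffunE.
have x0 : pos_pt x by move=> i; rewrite xu exprz_gt0.
(* The powers of 2 are given to the seed mutated once more at [l], so that the variable of [t] at
   [l] takes a value with the factor 1 + 2^m. *)
have [r [dr]] := cluster_algebra_dyadic (rcons w l) xu yA.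
have Bt : seed_mx t = mutate_mxs w (seed_mx s0) by exact: seed_mx_mutates.
have skt : skew_symmetrizable (seed_mx t) by rewrite Bt; exact: skew_mutates.
rewrite rev_rcons /mutate_mxs foldl_rcons -/(mutate_mxs _ _) -Bt /= mutate_mxK.
set z := mutate_pt _ _ _; set v := mutate_pts _ _ _ => vy.
have z0 : pos_pt z by exact: mutate_pt_gt0.
have v0 : pos_pt v by exact: mutate_pts_gt0.
have zE : mutate_pts w v (seed_mx s0) = z.
  rewrite -{1}(revK w) -(mutate_mxs_rev w (seed_mx s0)) -Bt.
  exact: mutate_pts_rev.
have valz i : val v (seed_var t i) (z i).
  by rewrite -zE; apply: value_mutates => // j; exact: value_gen.
have E := value_uniq indep (valueM vy (valz l)) _.
have {E} := E (exchange z C l); rewrite yE => /(_ (value_exchange indep C l z0 valz)).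
have -> : z l = exchange x (seed_mx t) l / x l.
  rewrite ffunE eqxx; congr (_ / _); rewrite -(exchangeN x (seed_mx t)).
  by apply: eq_exchange => // i; rewrite mutate_mxr mxE.
(* The points [z] and [x] differ at most at [l], where [C] has a zero entry. *)
have -> : exchange z C l = exchange x C l.
  apply: eq_exchange => // i Ci; rewrite ffunE; case: eqP => // il.
  by rewrite il Cll eqxx in Ci.
rewrite !exchange_mon // !(mon_exp2 _ xu) xu.
set a := dot u (exp_pos _); set b := dot u (exp_pos _) => E.
(* The monomial factors of both exchange polynomials and x_l are powers of 2, absorbed into the
   dyadic factor. *)
apply: (@dyadic_exp2D1_dvd (r * 2 ^ (a - u l - b))) => //.
  by rewrite rpredM // dyadic_exp2.
have c0 (c : int) : (2 : rat) ^ c != 0 by rewrite expfz_neq0.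
apply: (mulfI (c0 b)); rewrite -[RHS]E !expfzDr // -!invr_expz.
move: (c0 b) (c0 (u l)); move: (2 ^ a) (2 ^ b) (2 ^ u l) (2 ^ dot u _) => a' b' c' d'.
by move=> b0 c0'; field; rewrite b0 c0'.
Qed.

End ColumnComparison.

(** * Homomorphisms mapping a cluster to a cluster *)

Section Content.
Variable n : nat.
Implicit Types (B C : 'M[int]_n) (i j k l : 'I_n).

Definition content B k : nat := \big[gcdn/0%N]_i `|B i k|%N.

Lemma dvdn_contentP d B k : reflect (forall i, (d%:Z %| B i k)%Z) (d %| content B k)%N.
Proof.
apply: (iffP (dvdn_biggcdP _ _ _)) => [dB i|dB i _]; last by have := dB i; rewrite dvdzE.
by rewrite dvdzE; exact: dB.
Qed.

Lemma content_eq0 B k : (content B k == 0%N) = [forall i, B i k == 0].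
Proof.
rewrite -dvd0n; apply/dvdn_contentP/forallP => B0 i; first by have := B0 i; rewrite dvd0z.
by rewrite dvd0z.
Qed.

(** Each new entry of column k is a combination of old entries of that column and their positive
    parts; mutation being an involution, divisibility in one direction suffices. *)
Lemma content_mutate B j k : content (mutate_mx B j) k = content B k.
Proof.
suff le C : (content C k %| content (mutate_mx C j) k)%N.
  by apply/eqP; rewrite eqn_dvd -{2}(mutate_mxK B j) !le.
have /dvdn_contentP CB := dvdnn (content C k); apply/dvdn_contentP => i.
have [->|ij] := eqVneq i j; first by rewrite mutate_mxl rpredN.
have [kj|kj] := eqVneq k j; first by rewrite -kj mutate_mxr rpredN.
rewrite mutate_mx_pos_part //; apply: rpredD; first by rewrite rpredD // dvdz_mull.
apply: dvdz_mull; rewrite /pos_part; case: leP => // _; rewrite dvdz0.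
Qed.

Lemma content_mutates w B k : content (mutate_mxs w B) k = content B k.
Proof. by elim: w B => //= j w IH B; rewrite IH content_mutate. Qed.

(** Along each finite cycle of [s], divisibility closes up and forces equality. *)
Lemma perm_dvdn_eq (s : {perm 'I_n}) (D : 'I_n -> nat) :
  (forall k, D (s k) != 0%N -> D k != 0%N /\ (D (s k) %| D k)%N) ->
  forall k, D (s k) = D k.
Proof.
(* Replacing 0 by 1 and doubling the rest turns the hypothesis into plain divisibility; parity keeps
   the two kinds apart. *)
move=> Ds; pose E k := if D k == 0%N then 1%N else (D k).*2.
have Es k : (E (s k) %| E k)%N.
  rewrite /E; case: eqP => [_|/eqP/Ds[/negPf-> ]]; first exact: dvd1n.
  by rewrite -!muln2 dvdn_pmul2r.
have Esi a k : (E ((s ^+ a)%g k) %| E k)%N.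
  elim: a => [|a IH]; first by rewrite expg0 perm1.
  by apply: dvdn_trans IH; rewrite expgSr permM.
move=> k; have : E (s k) = E k.
  apply/eqP; rewrite eqn_dvd Es /=.
  have := Esi #[s]%g.-1 (s k); rewrite -permM -expgS prednK ?order_gt0 //.
  by rewrite expg_order perm1.
rewrite /E; do 2! case: eqP => [->|_] //.
- by move/(congr1 odd); rewrite odd_double.
- by move/(congr1 odd); rewrite odd_double.
- exact: double_inj.
Qed.

Lemma dot_single (e : {ffun 'I_n -> int}) i z :
  dot (single_exp i z) e = z * e i.
Proof.
rewrite /dot (bigD1 i) //= ffunE eqxx big1 ?addr0 // => j /negPf ji.
by rewrite ffunE ji mul0r.
Qed.

(** A coordinate with b_i nonzero gives the candidate a. For another j, L b_i + b_j divides L c_i +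
    c_j, hence also K = c_j - a b_j; for L large it exceeds K in absolute value, so K = 0. *)
Lemma dvd_functional_proportional (b c : {ffun 'I_n -> int}) :
  (forall u : 'I_n -> int, dot u b != 0 -> (dot u b %| dot u c)%Z) ->
  b != 0 -> exists a, forall i, c i = a * b i.
Proof.
move=> bc b0; have [i bi] : exists i, b i != 0.
  apply: contrapT => nb; case/eqP: b0; apply/ffunP => i; rewrite ffunE.
  by apply/eqP; apply: contra_notT nb => ?; exists i.
have /dvdzP[a ca] : (b i %| c i)%Z.
  by have := bc (single_exp i 1); rewrite !dot_single !mul1r; exact.
exists a => j; have := bc (single_exp i _ + single_exp j 1).
have dD L e : dot (single_exp i L + single_exp j 1) e = L * e i + e j.
  rewrite -[e j]mul1r -!dot_single /dot -big_split; apply: eq_bigr => l _.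
  by rewrite ffunE mulrDl.
pose K := c j - a * b j; move=> /(_ (`|K| + `|b j| + 1)); rewrite !dD ca.
set L := (`|K| + _ + _) => dvdL.
have big : `|K| < `|L * b i + b j|.
  rewrite /L; move: bi; clear; move: (b i) (b j) K => x y z x0.
  have := normr_ge0 z; have := ler_norm y; have := ler_norm (- y); rewrite normrN.
  case: (ltrP 0 x) => x1; [have : 1 <= x by lia | have : x <= -1 by lia] => x2; nia.
have : (L * b i + b j %| K)%Z.
  have -> : K = (L * (a * b i) + c j) - a * (L * b i + b j) by rewrite /K; ring.
  apply: rpredB; last exact: dvdz_mull.
  by apply: dvdL; apply: contraTneq big => ->; rewrite normr0 -leNgt.
case/dvdzP => q KE; have q0 : q = 0.
  move: big; rewrite KE normrM; move: (`|L * b i + b j|) (normr_ge0 (L * b i + b j)) => N N0.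
  by move: (normr_ge0 q) => q1 lt; apply/eqP; rewrite -normr_eq0; apply/eqP; nia.
by move: KE; rewrite q0 mul0r /K => /eqP; rewrite subr_eq0 => /eqP.
Qed.

End Content.

(** Natural exponents give the exchange polynomial a meaning in the cluster algebra, where variables
    need not be invertible, and let ring morphisms act on it. *)
Definition exchange_nat (R : comNzRingType) n (x : 'I_n -> R) (B : 'M[int]_n) k : R :=
  \prod_(i < n) x i ^+ `|pos_part (B i k)|%N + \prod_(i < n) x i ^+ `|pos_part (- B i k)|%N.

Lemma exchange_natE (K : fieldType) n (x : 'I_n -> K) B k :
  exchange_nat x B k = exchange x B k.
Proof.
have E y (z : int) : y ^+ `|pos_part z|%N = y ^ pos_part z :> K.
  by rewrite exprnP gez0_abs // /pos_part le_max lexx orbT.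
by congr (_ + _); apply: eq_bigr => i _; rewrite E.
Qed.

Lemma rmorph_exchange_nat (R S : comNzRingType) (h : {rmorphism R -> S}) n
    (x : 'I_n -> R) (y : 'I_n -> S) B k : (forall i, h (x i) = y i) ->
  h (exchange_nat x B k) = exchange_nat y B k.
Proof.
move=> xy; rewrite rmorphD !rmorph_prod; congr (_ + _); apply: eq_bigr => i _;
  by rewrite rmorphXn /= xy.
Qed.

Definition permute_mx n (s : {perm 'I_n}) (B : 'M[int]_n) : 'M[int]_n :=
  \matrix_(i, j) B ((s^-1)%g i) ((s^-1)%g j).

Lemma exchange_nat_perm (R : comNzRingType) n (s : {perm 'I_n}) (x : 'I_n -> R) B k :
  exchange_nat (fun i => x (s i)) B k = exchange_nat x (permute_mx s B) (s k).
Proof.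
congr (_ + _); rewrite [RHS](reindex_inj (@perm_inj _ s)) /=;
  by apply: eq_bigr => i _; rewrite !mxE !permK.
Qed.

(** * Variables of reachable seeds *)

Section Reachable.
Variables (n : nat) (s0 : seed_data n).
Hypothesis s0_seed : is_labeled_seed s0.

Let indep : forall p, ambient_eval (seed_var s0) p = 0 -> p = 0 := s0_seed.1.1.
Let skew0 : skew_symmetrizable (seed_mx s0) := s0_seed.2.
Implicit Types (s t : seed_of s0) (w : seq 'I_n).

Lemma seed_ofP s : exists w, s = mutates w s0 :> seed_data n.
Proof. exact/reachable_mutatesP/seed_of_reachable. Qed.

(** Mutating [z] back to the initial seed gives [v]. Prescribed values then show that variables are
    distinct and nonzero. *)
Lemma seed_of_values s (z : {ffun 'I_n -> rat}) : pos_pt z ->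
  exists v, forall i, value_at (seed_var s0) v (seed_var s i) (z i).
Proof.
have [w ->] := seed_ofP s; move=> z0.
have skw := skew_mutates w skew0.
exists (mutate_pts (rev w) z (mutate_mxs w (seed_mx s0))) => i.
set v := mutate_pts _ _ _.
have <- : mutate_pts w v (seed_mx s0) = z.
  by rewrite -{1}(revK w) -(mutate_mxs_rev w (seed_mx s0)) mutate_pts_rev.
by apply: value_mutates => //; [exact: mutate_pts_gt0 | move=> j; exact: value_gen].
Qed.

Lemma seed_of_skew s : skew_symmetrizable (seed_mx s).
Proof. by have [w ->] := seed_ofP s; rewrite seed_mx_mutates; exact: skew_mutates. Qed.

Lemma seed_of_content s k : content (seed_mx s) k = content (seed_mx s0) k.
Proof. by have [w ->] := seed_ofP s; rewrite seed_mx_mutates content_mutates. Qed.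

Lemma seed_of_var_inj s : injective (seed_var s).
Proof.
move=> i j ij; have [|v val] := seed_of_values s (z := [ffun i : 'I_n => i.+1%:R]).
  by move=> k; rewrite ffunE.
have := val j; rewrite -ij => /(value_uniq indep (val i)) /eqP.
by rewrite !ffunE eqr_nat eqSS => /eqP /val_inj.
Qed.

Lemma cvar_inj s : injective (cvar s).
Proof. by move=> i j /(congr1 val)/= /seed_of_var_inj. Qed.

Lemma seed_of_one_values s :
  exists v, forall i, value_at (seed_var s0) v (seed_var s i) ([ffun=> 1 : rat] i).
Proof. by apply: seed_of_values => i; rewrite ffunE. Qed.

Lemma seed_of_var_neq0 s k : seed_var s k != 0.
Proof.
have [v val] := seed_of_one_values s.
by apply: (value_neq0 indep (val k)); rewrite ffunE.
Qed.

Lemma seed_of_exchange_neq0 s B k : exchange (seed_var s) B k != 0.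
Proof.
have [v val] := seed_of_one_values s.
have one0 : pos_pt ([ffun=> 1] : {ffun 'I_n -> rat}) by move=> i; rewrite ffunE.
apply: (value_neq0 indep (value_exchange indep B k one0 val)).
by rewrite gt_eqF // exchange_gt0.
Qed.

Lemma mutate_seedK s k : mutate (mutate s k) k = s.
Proof.
have s0k := seed_of_var_neq0 s k; have e0 := seed_of_exchange_neq0 s (seed_mx s) k.
have Bkk : seed_mx s k k = 0 by rewrite skew_diag //; exact: seed_of_skew.
case: s s0k e0 Bkk => -[x B] /= _ s0k e0 Bkk.
rewrite /mutate /= mutate_mxK; congr SeedData; apply/ffunP => i.
rewrite ffunE; case: eqP => [->|/eqP/negPf ik]; last by rewrite ffunE ik.
rewrite /mutate_var /= -/(exchange _ _ _).
have -> : exchange [ffun i => if i == k then mutate_var (SeedData x B) k else x i]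
    (mutate_mx B k) k = exchange x B k.
  rewrite -(exchangeN x); apply: eq_exchange => j; first by rewrite mutate_mxr mxE.
  by rewrite mutate_mxr oppr_eq0 ffunE; case: (j =P k) => // ->; rewrite Bkk eqxx.
rewrite ffunE eqxx /mutate_var /= -/(exchange _ _ _).
by rewrite invf_div mulrC divfK.
Qed.

Definition mutate_seeds w s : seed_of s0 := foldl (@mutate_seed n s0) s w.

Lemma mutate_seedsE w s : mutate_seeds w s = mutates w s :> seed_data n.
Proof. by elim: w s => //= k w IH s; rewrite IH. Qed.

Lemma mutates_rev w s : mutates (rev w) (mutates w s) = s.
Proof.
elim: w s => //= k w IH s; rewrite rev_cons /mutates foldl_rcons -!/(mutates _ _).
by rewrite (IH (mutate_seed s k)) mutate_seedK.
Qed.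

Lemma mutates_back s : exists w, mutates w s = s0.
Proof.
have [w ->] := seed_ofP s; exists (rev w).
exact: (mutates_rev w (SeedOf (reach_init s0))).
Qed.

Lemma eq_cvar s t k l : seed_var s k = seed_var t l -> cvar s k = cvar t l.
Proof. by move=> st; apply: val_inj. Qed.

Lemma cvar_exchange s k :
  cvar (mutate_seed s k) k * cvar s k = exchange_nat (cvar s) (seed_mx s) k.
Proof.
apply: val_inj.
rewrite (rmorph_exchange_nat (h := val : {rmorphism _ -> _}) (y := seed_var s)) //.
rewrite exchange_natE rmorphM /= ffunE eqxx /mutate_var -/(exchange _ _ _) divfK //.
exact: seed_of_var_neq0.
Qed.

End Reachable.

(** * Compatibility of the homomorphism with mutation *)

Section ClusterHomomorphism.
Variables (n : nat) (s0 : seed_data n).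
Hypothesis s0_seed : is_labeled_seed s0.
Variable f : {rmorphism cluster_algebra s0 -> cluster_algebra s0}.
Implicit Types (s t : seed_of s0) (w : seq 'I_n) (e : {perm 'I_n}).

Definition matches e s t : Prop := forall i, f (cvar s i) = cvar t (e i).

(** Equality of sets makes the induced map of indices surjective; on a finite set it is then a
    permutation, without appeal to injectivity of [f]. *)
Lemma cluster_matches s t :
  (f @` cluster s)%fset = cluster t -> exists e, matches e s t.
Proof.
move=> fst.
have ex k : exists l, f (cvar s k) = cvar t l.
  have : f (cvar s k) \in cluster t by rewrite -fst in_imfset //= in_imfset.
  by case/imfsetP => l _ ->; exists l.
pose h k := projT1 (cid (ex k)).
have hE k : f (cvar s k) = cvar t (h k) by exact: (projT2 (cid (ex k))).
have hsurj l : exists k, h k = l.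
  have : cvar t l \in (f @` cluster s)%fset by rewrite fst in_imfset.
  case/imfsetP => _ /imfsetP[k _ ->]; rewrite hE => /(cvar_inj s0_seed) ->.
  by exists k.
have hinj : injective h.
  pose g l := projT1 (cid (hsurj l)).
  have gK : cancel g h by move=> l; exact: (projT2 (cid (hsurj l))).
  exact: can_inj (canF_sym gK).
by exists (perm hinj) => i; rewrite permE hE.
Qed.

Lemma matches_cluster e s t :
  matches e s t -> (f @` cluster s)%fset = cluster t.
Proof.
move=> st; apply/fsetP => y; apply/imfsetP/imfsetP => /=.
  by case=> _ /imfsetP[k _ ->] ->; exists (e k).
case=> k _ ->; exists (cvar s ((e^-1)%g k)); first exact: in_imfset.
by rewrite st permKV.
Qed.

Lemma exchange_image e s t k : matches e s t ->
  \val (f (cvar (mutate_seed s k) k)) * seed_var t (e k) =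
  exchange (seed_var t) (permute_mx e (seed_mx s)) (e k).
Proof.
move=> st; have -> : seed_var t (e k) = \val (cvar t (e k)) by [].
rewrite -st -rmorphM -rmorphM (cvar_exchange s0_seed).
rewrite (rmorph_exchange_nat (h := f) _ _ st) exchange_nat_perm.
rewrite (rmorph_exchange_nat (h := val : {rmorphism _ -> _}) (y := seed_var t)) //.
exact: exchange_natE.
Qed.

Lemma matches_column e s t k : matches e s t ->
  column (seed_mx t) (e k) != 0 ->
  column (permute_mx e (seed_mx s)) (e k) != 0 /\
  exists a, forall i, permute_mx e (seed_mx s) i (e k) = a * seed_mx t i (e k).
Proof.
set c := column (permute_mx _ _) _; set b := column _ _; move=> st b0.
have dvd (u : 'I_n -> int) : dot u b != 0 -> dot u c != 0 /\ (dot u b %| dot u c)%Z.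
  have [w tE] := seed_ofP t; rewrite /b tE.
  apply: (exchange_column_dvd s0_seed (y := \val (f (cvar (mutate_seed s k) k)))).
  - by rewrite mxE skew_diag //; exact: seed_of_skew.
  - exact: valP.
  - by rewrite -tE; exact: exchange_image.
split.
  have [i bi] : exists i, b i != 0.
    apply: contrapT => nb; case/eqP: b0; apply/ffunP => i; rewrite [RHS]ffunE.
    by apply/eqP; apply: contra_notT nb => ?; exists i.
  have [] := dvd (single_exp i 1); first by rewrite dot_single mul1r.
  by rewrite dot_single mul1r => + _; apply: contraNneq => ->; rewrite ffunE.
have [|a ca] := dvd_functional_proportional _ b0 (c := c); first by move=> u /dvd[].
by exists a => i; have := ca i; rewrite !ffunE.
Qed.

Lemma column_eq0 (B : 'M[int]_n) k : (column B k == 0) = (content B k == 0%N).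
Proof.
rewrite content_eq0; apply/eqP/forallP => [B0 i|B0].
  by have := congr1 (fun h : {ffun _} => h i) B0; rewrite !ffunE => ->.
by apply/ffunP => i; rewrite !ffunE; exact/eqP.
Qed.

Lemma content_permute e (B : 'M[int]_n) k : content (permute_mx e B) (e k) = content B k.
Proof.
rewrite /content [LHS](reindex_inj (@perm_inj _ e)) /=.
by apply: eq_bigr => i _; rewrite mxE !permK.
Qed.

(** Proportional columns give divisibility of contents, and contents agree in all seeds, so the
    cycle argument applies to the initial matrix. *)
Lemma matches_content e s t k :
  matches e s t -> content (seed_mx s0) (e k) = content (seed_mx s0) k.
Proof.
move=> st; move: k; apply: perm_dvdn_eq => k.
rewrite -(seed_of_content t) -(seed_of_content s).
rewrite -(content_permute e (seed_mx s)) -column_eq0 => /(matches_column st)[c0 [a ca]].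
rewrite -column_eq0; split=> //; apply/dvdn_contentP => i.
rewrite ca; apply: dvdz_mull.
by apply/dvdn_contentP: i.
Qed.

(** Equal nonzero contents force the factor between the columns to be 1 or -1, and a sign only swaps
    the two terms of the exchange polynomial. *)
Lemma matches_exchange e s t k : matches e s t ->
  exchange (seed_var t) (permute_mx e (seed_mx s)) (e k) =
  exchange (seed_var t) (seed_mx t) (e k).
Proof.
move=> st; set C := permute_mx _ _.
have cont : content C (e k) = content (seed_mx t) (e k).
  by rewrite content_permute !(seed_of_content) (matches_content k st).
have [t0|t0] := eqVneq (column (seed_mx t) (e k)) 0.
  have C0 : column C (e k) = 0 by apply/eqP; rewrite column_eq0 cont -column_eq0 t0.
  apply: eq_exchange => // i.
  have := congr1 (fun h : {ffun _} => h i) t0; have := congr1 (fun h : {ffun _} => h i) C0.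
  by rewrite !ffunE => -> ->.
have [_ [a ca]] := matches_column st t0.
have a1 : `|a|%N = 1%N.
  have c0 : (0 < content (seed_mx t) (e k))%N by rewrite lt0n -column_eq0.
  apply/eqP; rewrite -dvdn1 -(dvdn_pmul2r c0) mul1n -{2}cont.
  apply/dvdn_contentP => i; rewrite ca PoszM dvdzE !abszM !absz_nat dvdn_mul //.
  by have /dvdn_contentP/(_ i) := dvdnn (content (seed_mx t) (e k)); rewrite dvdzE.
case: (ltrP a 0) => a0; last first.
  by apply: eq_exchange => // i; rewrite ca (_ : a = 1) ?mul1r //; lia.
rewrite -[RHS]exchangeN; apply: eq_exchange => // i.
by rewrite ca mxE (_ : a = -1) ?mulN1r //; lia.
Qed.

Lemma matches_mutate e s t k :
  matches e s t -> matches e (mutate_seed s k) (mutate_seed t (e k)).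
Proof.
move=> st i; have [->|ik] := eqVneq i k; last first.
  rewrite (_ : cvar _ i = cvar s i); last first.
    by apply: eq_cvar; rewrite ffunE (negPf ik).
  rewrite st; apply: eq_cvar; rewrite ffunE.
  by rewrite (inj_eq perm_inj) (negPf ik).
apply: val_inj; have z0 := seed_of_var_neq0 s0_seed t (e k).
apply: (mulIf z0); rewrite (exchange_image k st) (matches_exchange k st) /=.
by rewrite ffunE eqxx /mutate_var -/(exchange _ _ _) divfK.
Qed.

Lemma matches_mutate_seeds e s t w :
  matches e s t -> matches e (mutate_seeds w s) (mutate_seeds (map e w) t).
Proof. by elim: w s t => //= k w IH s t st; apply/IH/matches_mutate. Qed.

Lemma mapKV_perm e w : map e (map (e^-1)%g w) = w.
Proof. by rewrite -map_comp map_id_in // => i _ /=; rewrite permKV. Qed.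

(** The image is a subring. A cluster variable is reached from [t] by some sequence, and the
    sequence relabelled by the inverse of [e], applied to [s], gives a preimage. *)
Lemma matches_surj e s t : matches e s t -> forall y, exists a, f a = y.
Proof.
move=> st y.
pose S : {pred ambient n} := fun y => `[< exists a, \val (f a) = y >].
suff /asboolP[a ay] : \val y \in S by exists a; apply: val_inj.
have /cluster_algebra_predP := valP y; apply.
  split=> [|_ _ /asboolP[a <-] /asboolP[b <-]|_ _ /asboolP[a <-] /asboolP[b <-]];
    apply/asboolP.
  - by exists 1; rewrite !rmorph1.
  - by exists (a - b); rewrite !rmorphB.
  - by exists (a * b); rewrite !rmorphM.
move=> _ [s' [k [/reachable_mutatesP[w ->] ->]]]; apply/asboolP.
have [wt tE] := mutates_back s0_seed t.
have -> : mutates w s0 = mutates (wt ++ w) t by rewrite mutates_cat tE.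
have := matches_mutate_seeds (map (e^-1)%g (wt ++ w)) st => /(_ ((e^-1)%g k)).
rewrite mapKV_perm permKV => E; exists (cvar (mutate_seeds (map (e^-1)%g (wt ++ w)) s)
  ((e^-1)%g k)); rewrite E /=.
by rewrite mutate_seedsE.
Qed.

Lemma divring_mutates (S : divringClosed (ambient n)) w (s : seed_data n) :
  (forall i, seed_var s i \in S) -> forall i, seed_var (mutates w s) i \in S.
Proof.
elim: w s => //= k w IH s sS; apply: IH => i; rewrite ffunE; case: eqP => // _.
rewrite /mutate_var -/(exchange _ _ _) -exchange_natE.
by apply: rpred_div => //; apply: rpredD; apply: rpred_prod => j _; apply: rpredX.
Qed.

(** Rational coefficients are quotients of integers, and every element is a quotient of polynomials
    in the initial variables. *)
Lemma divring_full (S : divringClosed (ambient n)) :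
  (forall i, seed_var s0 i \in S) -> forall y, y \in S.
Proof.
move=> S0; have evS p : ambient_eval (seed_var s0) p \in S.
  apply: rpred_sum => m _; apply: rpredM; last first.
    by apply: rpred_prod => i _; rewrite rpredX.
  rewrite -/(coef_embed n _) -(divq_num_den p@_m) fmorph_div !rmorph_int.
  by rewrite rpred_div ?rpred_int.
move=> y; have [p [q [q0 ->]]] := s0_seed.1.2 y.
by rewrite rpred_div.
Qed.

(** Let [s'] be the seed that [f] sends to the initial one. On polynomials in its variables, [f] is
    injective by algebraic independence of the initial variables; any a is a quotient b / c of such
    polynomials, so f a = 0 gives f b = 0, then b = 0 and a = 0. *)
Lemma matches_inj e s t : matches e s t -> injective f.
Proof.
move=> st; have [wt tE] := mutates_back s0_seed t.
pose s' := mutate_seeds (map (e^-1)%g wt) s.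
have fs' i : \val (f (cvar s' ((e^-1)%g i))) = seed_var s0 i.
  rewrite (matches_mutate_seeds _ st) mapKV_perm permKV /=.
  by rewrite mutate_seedsE tE.
pose x i := seed_var s' ((e^-1)%g i).
(* The same polynomial [p] must represent both [a] and its image; vanishing of the image then gives
   p = 0. *)
pose Z a := exists p, \val a = ambient_eval x p /\ \val (f a) = ambient_eval (seed_var s0) p.
have Z0 a : Z a -> f a = 0 -> a = 0.
  move=> [p [ap fap]] fa0; apply: val_inj; rewrite ap.
  have /(s0_seed.1.1)-> : ambient_eval (seed_var s0) p = 0 by rewrite -fap fa0 rmorph0.
  by rewrite ambient_evalE !rmorph0.
have ZD a b : Z a -> Z b -> Z (a + b).
  move=> [p [ap fap]] [q [bq fbq]]; exists (p + q).
  by rewrite !ambient_evalD !rmorphD /= ap bq fap fbq.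
have ZN a : Z a -> Z (- a).
  by move=> [p [ap fap]]; exists (- p); rewrite !ambient_evalN !rmorphN /= ap fap.
have ZM a b : Z a -> Z b -> Z (a * b).
  move=> [p [ap fap]] [q [bq fbq]]; exists (p * q).
  by rewrite !ambient_evalM !rmorphM /= ap bq fap fbq.
have Z1 : Z 1 by exists 1; rewrite !ambient_eval1 !rmorph1.
pose S : {pred ambient n} := fun y =>
  `[< exists a b, [/\ Z a, Z b, b != 0 & y * \val b = \val a] >].
have val0 (a : cluster_algebra s0) : a != 0 -> \val a != 0 :> ambient n.
  by apply: contraNneq => a0; apply/eqP/val_inj; rewrite a0 rmorph0.
have Sdiv : divring_closed S.
  split=> [|y z /asboolP[a [b [Za Zb b0 yE]]] /asboolP[c [d [Zc Zd d0 zE]]]|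
            y z /asboolP[a [b [Za Zb b0 yE]]] /asboolP[c [d [Zc Zd d0 zE]]]]; apply/asboolP.
  - by exists 1, 1; rewrite oner_neq0 mul1r.
  - exists (a * d - c * b), (b * d); split; [|exact: ZM| |].
    + by apply: ZD; [exact: ZM | apply/ZN/ZM].
    + by apply: contraNneq (mulf_neq0 (val0 _ b0) (val0 _ d0)) => bd0;
        rewrite -rmorphM bd0 rmorph0.
    + by move: yE zE; rewrite rmorphB !rmorphM /= => <- <-; ring.
  - have [z0|z0] := eqVneq z 0.
      exists 0, 1; rewrite z0 invr0 mulr0 mul0r rmorph0 oner_neq0; split=> //.
      by exists 0; rewrite !ambient_evalE !rmorph0.
    have c0 : c != 0.
      apply: contraNneq (mulf_neq0 z0 (val0 _ d0)) => c0.
      by rewrite zE c0 rmorph0.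
    exists (a * d), (b * c); split; try exact: ZM.
      by apply: contraNneq (mulf_neq0 (val0 _ b0) (val0 _ c0)) => bc0;
        rewrite -rmorphM bc0 rmorph0.
    by move: yE zE; rewrite !rmorphM /= => <- <-; rewrite (mulrCA (ca_val b)) -!mulrA mulKf.
pose S' := HB.pack_for (divringClosed (ambient n)) S
  (GRing.isDivringClosed.Build (ambient n) S Sdiv).
(* The fractions contain the variables of [s'], and mutating from there reaches the initial
   variables by field operations. *)
have S0 i : seed_var s0 i \in S'.
  have [w wE] := mutates_back s0_seed s'.
  rewrite -wE; apply: divring_mutates => {}i; apply/asboolP.
  exists (cvar s' i), 1; rewrite mulr1 oner_neq0; split=> //.
  exists 'X_(e i); rewrite !ambient_evalX -(fs' (e i)) /x permK.
  by split.
apply: raddf_inj => a fa0.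
have /asboolP[b [c [Zb Zc c0 acb]]] : \val a \in S' by exact: divring_full.
have {}acb : a * c = b by apply: val_inj; rewrite rmorphM.
have b0 : b = 0 by apply: Z0 => //; rewrite -acb rmorphM fa0 mul0r.
apply/eqP/negPn/negP => a0; have := mulf_neq0 (val0 _ a0) (val0 _ c0).
by rewrite -rmorphM acb b0 rmorph0 eqxx.
Qed.

Lemma matches_cluster_automorphism e s t :
  matches e s t -> is_cluster_automorphism f.
Proof.
move=> st; have surj := matches_surj st; split.
  pose g y := projT1 (cid (surj y)).
  have gK : cancel g f by move=> y; exact: (projT2 (cid (surj y))).
  by exists g => // a; apply: (matches_inj st); rewrite gK.
exists s, t; split; first exact: matches_cluster st.
move=> k l; rewrite st => /(cvar_inj s0_seed) <-.
exact: matches_cluster (matches_mutate k st).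
Qed.

End ClusterHomomorphism.

Theorem theorem3p6 (n : nat) (n_ge1 : (1 <= n)%N) (s0 : seed_data n)
    (s0_seed : is_labeled_seed s0)
    (f : {rmorphism cluster_algebra s0 -> cluster_algebra s0}%R) :
  is_cluster_automorphism f <->
  exists X Z : {fset cluster_algebra s0},
    is_cluster X /\ is_cluster Z /\ (f @` X)%fset = Z.
Proof.
split=> [[_ [s [t [fst _]]]]|[_ [_ [[s ->] [[t ->] fst]]]]].
  by exists (cluster s), (cluster t); split; [exists s | split; first exists t].
have [e st] := cluster_matches s0_seed fst.
exact: matches_cluster_automorphism st.
Qed.
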